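(* Let $r\geq 2$ be an integer and let $p=p(n)$ satisfy $p=\omega(n^{-1})$ and $p=o(n^{-1/r})$. Consider bootstrap percolation with infection threshold $r$ on the binomial random graph $G(n,p)$, where the initially infected set $\mathcal{A}(0)$ is chosen uniformly at random among all vertex subsets of size $a$, and let $\mathcal{A}_f$ be the final infected set. Let $a_c$ and $t_0$ be as defined in the context, and let $\alpha=\alpha(n)$ be any function with $\alpha=\omega(\sqrt{a_c})$ and $\alpha\leq t_0-a_c$. If $|\mathcal{A}(0)|=a_c+\alpha$, then with probability at least $$1-\exp\left(-(1+o(1))\frac{r\alpha^2}{8(t_0+r\alpha/3)}\right)-\exp\left(-(1+o(1))\frac{(r-1)\alpha^2}{8(t_0+(r-1)\alpha/2)}\right)$$ we have $|\mathcal{A}_f|=(1+o(1))n$.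
   Context: $G(n,p)$ has vertex set $[n]=\{1,\dots,n\}$, each edge present independently with probability $p$. Bootstrap percolation with threshold $r$: starting from $\mathcal{A}(0)$, in each round every uninfected vertex with at least $r$ infected neighbours becomes infected; infected vertices stay infected; $\mathcal{A}_f$ is the set of infected vertices when the process stabilises. All asymptotics are as $n\to\infty$ and $n$ is assumed sufficiently large. Define $\delta:=\max\{(np^r)^{1/(2(r-1))},(np)^{-1/(4(r-1))}\}$ (so $\delta=o(1)$), $t_0:=\left((1+\delta)\frac{(r-1)!}{np^r}\right)^{1/(r-1)}$, $\hat{\pi}(t):=\mathbb{P}[\mathrm{Bin}(t,p)\geq r]$, and $a_c:=-\min_{t\leq t_0}\frac{n\hat{\pi}(t)-t}{1-\hat{\pi}(t)}$. *)

(* Defs.v *)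
From HB Require Import structures.
From mathcomp Require Import all_boot all_order all_algebra.
From mathcomp Require Import all_classical all_reals all_analysis.

Set Implicit Arguments.
Unset Strict Implicit.
Unset Printing Implicit Defensive.

Import Order.TTheory GRing.Theory Num.Theory.
Import numFieldNormedType.Exports.

Local Open Scope ring_scope.

(** A simple graph on the vertex set 'I_n is encoded by its edge set
    E \subset complete_edges n; u and v are adjacent iff [set u; v] \in E. *)

Definition complete_edges (n : nat) : {set {set 'I_n}} :=
  [set e : {set 'I_n} | #|e| == 2%N].

Definition bootstrap_round (n r : nat) (E : {set {set 'I_n}})
    (A : {set 'I_n}) : {set 'I_n} :=
  A :|: [set v | (v \notin A) &&
                 (r <= #|[set u in A | [set u; v] \in E]|)%N].

(** A round that changes something infects at least one of the n vertices, so
    the process is stable after n rounds (see [bootstrap_final_stable]). *)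
Definition bootstrap_final (n r : nat) (E : {set {set 'I_n}})
    (A : {set 'I_n}) : {set 'I_n} :=
  iter n (bootstrap_round r E) A.

Lemma bootstrap_final_stable (n r : nat) (E : {set {set 'I_n}})
    (A : {set 'I_n}) :
  bootstrap_round r E (bootstrap_final r E A) = bootstrap_final r E A.
Proof.
rewrite /bootstrap_final; set f := bootstrap_round r E.
have sub (B : {set _}) : B \subset f B by apply: finset.subsetUl.
have grow k : f (iter k f A) = iter k f A \/ (k <= #|iter k f A|)%N.
  elim: k => [|k [IH|IH]]; [by right | by left; rewrite iterS !IH |].
  have [e|ne] := eqVneq (f (iter k f A)) (iter k f A).
    by left; rewrite iterS !e.
  right; rewrite iterS; apply: leq_ltn_trans IH _.
  by apply: proper_card; rewrite finset.properEneq eq_sym ne sub.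
have [//|le] := grow n.
have /eqP AT : iter n f A == [set: 'I_n].
  by rewrite finset.eqEcard finset.subsetT cardsT card_ord.
by apply/eqP; rewrite finset.eqEsubset sub andbT AT finset.subsetT.
Qed.

Definition gnp_weight (R : realType) (n : nat) (p : R)
    (E : {set {set 'I_n}}) : R :=
  \prod_(e in complete_edges n) (if e \in E then p else 1 - p).

(** Probability of the event Q (graph, initially infected set) when the graph
    is G(n,p) and, independently, the initially infected set is uniform among
    the vertex subsets of size a. *)
Definition bootstrap_prob (R : realType) (n : nat) (p : R) (a : nat)
    (Q : {set {set 'I_n}} -> {set 'I_n} -> bool) : R :=
  \sum_(E : {set {set 'I_n}} | E \subset complete_edges n)
    \sum_(A : {set 'I_n} | (#|A| == a) && Q E A)
      gnp_weight p E / #|[set B : {set 'I_n} | #|B| == a]|%:R.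

Section Thresholds.
Context {R : realType}.
Local Open Scope classical_set_scope.

Definition delta (r n : nat) (p : R) : R :=
  Num.max ((n%:R * p ^+ r) `^ (2 * (r%:R - 1))^-1)
          ((n%:R * p) `^ (- (4 * (r%:R - 1))^-1)).

Definition t0 (r n : nat) (p : R) : R :=
  ((1 + delta r n p) * ((r.-1)`!%:R / (n%:R * p ^+ r))) `^ (r%:R - 1)^-1.

Definition pi_hat (r : nat) (p : R) (t : nat) : R :=
  fine (binomial_prob t p [set k | (r <= k)%N]).

Definition drift (r n : nat) (p : R) (t : nat) : R :=
  (n%:R * pi_hat r p t - t%:R) / (1 - pi_hat r p t).

(** The minimum is over the integers 0 <= t <= t0, i.e. t <= truncn t0
    (0 <= t0 always holds); using the value at t = 0 as the base of the
    iterated minimum adds no element. *)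
Definition a_c (r n : nat) (p : R) : R :=
  - \big[Num.min/drift r n p 0]_(t < (Num.truncn (t0 r n p)).+1) drift r n p t.

(** f = omega(g); as f is eventually above every multiple of |g|, it is in
    particular eventually nonnegative. *)
Definition is_littleomega (f g : nat -> R) : Prop :=
  forall K : R, 0 < K -> \forall n \near \oo, K * `|g n| <= f n.

End Thresholds.

(* Main.v *)
(** Fix the initial set A and use the infected vertices one at a time, exposing at step t
    the edges from the t-th used vertex to all unused ones. Completing the exposed edges by
    independent coins, every vertex outside A collects independent Bernoulli(p) marks, and
    the number S(t) of those with at least r marks after t steps satisfies
    |A_f| = min {t : a + S(t) <= t}. So one needs a + S(t) > t for all t <= (1 - o(1)) n.

    With N = n - a, the process (N - S(t)) / (1 - pi(t)) is a martingale in t and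
    S(t) / pi(t) is a martingale in reversed time; both are normalized counts of a decreasing
    family of events, so one maximal inequality for exp (mu Z) covers both. The normalization
    by 1 - pi is the one in the definition of a_c: up to time t1 = 4^(1/r) t0 the forward
    bound at level alpha keeps a + S(t) > t, because the barrier only rises after t0.
    After t1 the reverse bound S(t) > (79/100) N pi(t) suffices until t is linear in n, and
    then S(t) > (1 - o(1)) N pi(t) with pi(t) = 1 - o(1). At t1 the variance N pi(t1) is at
    most (4 + o(1)) t0 / r, so each of the three failure probabilities is at most exp (-E)
    with E the exponent of the second term, and E tends to infinity, which lets its
    o(1) absorb the factor 3. *)

Require Import Defs.
From HB Require Import structures.
From mathcomp Require Import all_boot all_order all_algebra.
From mathcomp Require Import all_classical all_reals all_analysis.
From mathcomp Require Import ring lra zify.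
Import Order.TTheory GRing.Theory Num.Theory.
Import numFieldNormedType.Exports.
Local Open Scope ring_scope.

Set Implicit Arguments.
Unset Strict Implicit.
Unset Printing Implicit Defensive.

(** * Random subsets *)

Definition bern_weight (R : realType) (T : finType) (D : {set T}) (p : R)
    (E : {set T}) : R :=
  \prod_(e in D) (if e \in E then p else 1 - p).

Definition bern_exp (R : realType) (T : finType) (D : {set T}) (p : R)
    (f : {set T} -> R) : R :=
  \sum_(E : {set T} | E \subset D) bern_weight D p E * f E.

Section BernoulliSubset.
Context {R : realType} (p : R).
Hypothesis p01 : 0 <= p <= 1.

Lemma bern_weight_ge0 (T : finType) (D E : {set T}) : 0 <= bern_weight D p E.
Proof.
case/andP: p01 => p0 p1; apply: prodr_ge0 => e _.
by case: ifP => // _; rewrite subr_ge0.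
Qed.

Lemma bern_exp1 (T : finType) (D : {set T}) : bern_exp D p (fun=> 1) = 1.
Proof.
rewrite /bern_exp /bern_weight.
under eq_bigr do rewrite mulr1.
have -> : \sum_(E : {set T} | E \subset D)
    \prod_(e in D) (if e \in E then p else 1 - p) =
  \sum_(E in powerset D) ((\prod_(e in E) p) * \prod_(e in D :\: E) (1 - p)).
  apply: eq_big => [E|E sED]; first by rewrite powersetE.
  rewrite (big_setID E) /= (finset.setIidPr sED); congr (_ * _).
    by apply: eq_bigr => e ->.
  by apply: eq_bigr => e; rewrite finset.inE => /andP[/negbTE ->].
transitivity (\prod_(i : T) ((if i \in D then p else 0) + (if i \in D then 1 - p else 1))); last first.
  by rewrite big1 // => i _; case: ifP => _; rewrite ?add0r // addrC subrK.
rewrite bigA_distr /=.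
rewrite [RHS](bigID (fun J : {set T} => J \subset D)) /= [X in _ = _ + X]big1 ?addr0; last first.
  move=> J /subsetPn[x xJ xD].
  by rewrite (bigD1 x) //= xJ (negbTE xD) mul0r.
apply: eq_big => [E|E]; first by rewrite powersetE.
rewrite powersetE => sED.
rewrite [RHS](bigID (mem D)) /= [X in _ = _ * X]big1 ?mulr1; last first.
  move=> i iD; rewrite (negbTE iD); case: ifP => // iE.
  by rewrite (fintype.subsetP sED i iE) in iD.
rewrite [RHS](bigID (mem E)) /=; congr (_ * _).
  apply: eq_big => [i|i iE].
    by apply/idP/andP => [iE|[]//]; split=> //; exact: (fintype.subsetP sED).
  by rewrite iE (fintype.subsetP sED i iE).
apply: eq_big => [i|i]; rewrite finset.inE; first exact: andbC.
by move=> /andP[/negbTE -> ->].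
Qed.

Lemma bern_exp_le (T : finType) (D : {set T}) (f g : {set T} -> R) :
  (forall E : {set T}, E \subset D -> f E <= g E) -> bern_exp D p f <= bern_exp D p g.
Proof.
by move=> fg; apply: ler_sum => E sE; rewrite ler_wpM2l ?bern_weight_ge0 ?fg.
Qed.

Lemma eq_bern_exp (T : finType) (D : {set T}) (f g : {set T} -> R) :
  (forall E : {set T}, E \subset D -> f E = g E) -> bern_exp D p f = bern_exp D p g.
Proof. by move=> fg; apply: eq_bigr => E sE; rewrite fg. Qed.

(* Exchanging the [j @: W]-part of E with N is a weight-preserving involution of
   the pairs (E, N). *)
Lemma bern_exp_resample (V T : finType) (D : {set T}) (W : {set V})
    (j : V -> T) (f : {set T} -> R) :
  {in W &, injective j} -> j @: W \subset D ->
  bern_exp D p f =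
  bern_exp W p (fun N => bern_exp D p (fun E => f (E :\: j @: W :|: j @: N))).
Proof.
move=> jI jD.
pose sw (x : {set T} * {set V}) : {set T} * {set V} :=
  (x.1 :\: j @: W :|: j @: x.2, [set w in W | j w \in x.1]).
have inN (E : {set T}) (N : {set V}) w : N \subset W -> w \in W ->
    (j w \in (E :\: j @: W :|: j @: N)) = (w \in N).
  move=> sN wW; rewrite !finset.inE (imset_f j wW) /=.
  apply/imsetP/idP => [[w' w'N /jI ->]//|wN]; last by exists w.
  exact: (fintype.subsetP sN).
have inN' (E : {set T}) (N : {set V}) e : N \subset W -> e \notin j @: W ->
    (e \in (E :\: j @: W :|: j @: N)) = (e \in E).
  move=> sN eW; rewrite !finset.inE eW /=; case: (e \in E) => //=.
  apply/imsetP => -[w wN ee]; move: eW; rewrite ee imset_f //.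
  exact: (fintype.subsetP sN).
have swD (x : {set T} * {set V}) : (x.1 \subset D) && (x.2 \subset W) ->
    ((sw x).1 \subset D) && ((sw x).2 \subset W).
  case: x => E N /= /andP[sE sN]; apply/andP; split.
    rewrite finset.subUset; apply/andP; split.
      exact: fintype.subset_trans (finset.subsetDl _ _) sE.
    exact: fintype.subset_trans (imsetS _ sN) jD.
  by apply/fintype.subsetP => w; rewrite finset.inE => /andP[].
have swK (x : {set T} * {set V}) : (x.1 \subset D) && (x.2 \subset W) -> sw (sw x) = x.
  case: x => E N /= /andP[sE sN]; rewrite /sw /=; congr (_, _); last first.
    apply/finset.setP => w; rewrite finset.in_set.
    case: (boolP (w \in W)) => [wW|wW] /=; first by rewrite inN.
    by apply/esym/negbTE; apply: contra wW; exact: (fintype.subsetP sN).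
  have sN2 : [set w in W | j w \in E] \subset W.
    by apply/fintype.subsetP => w; rewrite finset.inE => /andP[].
  apply/finset.setP => e; case: (boolP (e \in j @: W)) => [|eW].
    by case/imsetP=> w wW ->; rewrite inN // finset.inE wW.
  by rewrite inN' // inN'.
have wsw (x : {set T} * {set V}) : (x.1 \subset D) && (x.2 \subset W) ->
    bern_weight D p (sw x).1 * bern_weight W p (sw x).2 =
    bern_weight D p x.1 * bern_weight W p x.2.
  case: x => E N /= /andP[sE sN].
  have split0 (F : {set T}) : bern_weight D p F =
      (\prod_(w in W) (if j w \in F then p else 1 - p)) *
      \prod_(e in D :\: j @: W) (if e \in F then p else 1 - p).
    rewrite /bern_weight (big_setID (j @: W)) /= (finset.setIidPr jD).
    by rewrite big_imset.
  rewrite !split0 mulrAC [RHS]mulrAC; congr (_ * _); last first.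
    by apply: eq_bigr => e; rewrite finset.inE => /andP[eW _]; rewrite inN'.
  rewrite mulrC; congr (_ * _); rewrite /bern_weight.
    by apply: eq_bigr => w wW; rewrite finset.inE wW.
  by apply: eq_bigr => w wW; rewrite inN.
have H (g : {set T} -> R) : bern_exp D p g =
    \sum_(x : {set T} * {set V} | (x.1 \subset D) && (x.2 \subset W))
      bern_weight D p x.1 * bern_weight W p x.2 * g x.1.
  rewrite -(pair_big (fun E : {set T} => E \subset D) (fun N : {set V} => N \subset W)
    (fun E N => bern_weight D p E * bern_weight W p N * g E)) /=.
  apply: eq_bigr => E _.
  under eq_bigr do rewrite mulrAC.
  rewrite -mulr_sumr.
  have := bern_exp1 W; rewrite /bern_exp.
  by under eq_bigr do rewrite mulr1; move=> ->; rewrite mulr1.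
rewrite H (reindex_onto sw sw) /=; last by move=> x /swK.
have -> : bern_exp W p (fun N => bern_exp D p (fun E => f (E :\: j @: W :|: j @: N)))
  = \sum_(x : {set T} * {set V} | (x.1 \subset D) && (x.2 \subset W))
      bern_weight D p x.1 * bern_weight W p x.2 * f (sw x).1.
  rewrite -(pair_big (fun E : {set T} => E \subset D) (fun N : {set V} => N \subset W)
    (fun E N => bern_weight D p E * bern_weight W p N * f (sw (E, N)).1)) /=.
  rewrite exchange_big /=; apply: eq_bigr => N _; rewrite /bern_exp mulr_sumr.
  by apply: eq_bigr => E _; rewrite /sw /= mulrCA !mulrA.
apply: eq_big => [x|x /andP[sx /eqP swx]]; last first.
  have sx' : (x.1 \subset D) && (x.2 \subset W) by rewrite -swx; exact: swD.
  by rewrite -(wsw _ sx').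
apply/andP/idP => [[sx /eqP swx]|sx].
  by rewrite -swx; apply: swD.
by rewrite swK // eqxx; split=> //; exact: swD.
Qed.

End BernoulliSubset.

(** * Exploration of the graph *)

Section Exploration.
Context {n : nat} (r : nat) (A : {set 'I_n}).

Definition infected (c : {ffun 'I_n -> nat}) : {set 'I_n} :=
  A :|: [set v | (r <= c v)%N].

Definition add_marks (c : {ffun 'I_n -> nat}) (N : {set 'I_n}) :
  {ffun 'I_n -> nat} := [ffun v => (c v + (v \in N))%N].

(* [U] is the set of vertices whose edges have been exposed and [c v] the number
   of neighbours of [v] among them, counted when they were exposed. *)
Fixpoint explore (k : nat) (E : {set {set 'I_n}}) (U : {set 'I_n})
    (c : {ffun 'I_n -> nat}) : {set 'I_n} :=
  if k is k'.+1 then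
    if [pick u in infected c :\: U] is Some u then
      explore k' E (u |: U)
        (add_marks c [set v in ~: (u |: U) | [set u; v] \in E])
    else U
  else U.

Lemma explore_sub k (E : {set {set 'I_n}}) (U : {set 'I_n}) (c : {ffun 'I_n -> nat}) (F : {set 'I_n}) :
  A \subset F -> bootstrap_round r E F = F -> U \subset F ->
  (forall v, c v <= #|[set u in U | [set u; v] \in E]|)%N ->
  explore k E U c \subset F.
Proof.
move=> sAF stF; elim: k U c => [//|k IH] U c sUF cU /=.
case: pickP => [u|//]; rewrite !finset.inE => /andP[uU uI].
have uF : u \in F.
  case/orP: uI => [|rc]; first exact: (fintype.subsetP sAF).
  rewrite -stF !finset.inE; case: (boolP (u \in F)) => //= _.
  apply: leq_trans rc (leq_trans (cU u) _); apply: subset_leq_card.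
  apply/fintype.subsetP => w; rewrite !finset.inE => /andP[wU ->].
  by rewrite (fintype.subsetP sUF).
apply: IH => [|v].
  by rewrite finset.subUset finset.sub1set uF.
rewrite ffunE.
rewrite (cardsD1 u) !finset.inE eqxx /= addnC; apply: leq_add.
  by case: (_ \in E); rewrite ?andbF ?leq_b1.
apply: leq_trans (cU v) _; apply: subset_leq_card.
apply/fintype.subsetP => w; rewrite !finset.inE => /andP[wU ->].
rewrite wU orbT !andbT; apply: contraNneq uU => <- //.
Qed.

Lemma eq_explore k (E E' : {set {set 'I_n}}) (U : {set 'I_n}) (c : {ffun 'I_n -> nat}) :
  (forall x y, x \notin U -> y \notin U ->
     ([set x; y] \in E) = ([set x; y] \in E')) ->
  explore k E U c = explore k E' U c.
Proof.
elim: k U c => [//|k IH] U c EE' /=.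
case: pickP => [u|//]; rewrite finset.inE => /andP[uU _].
have -> : [set v in ~: (u |: U) | [set u; v] \in E] =
          [set v in ~: (u |: U) | [set u; v] \in E'].
  apply/finset.setP => v; rewrite !finset.inE negb_or.
  by case: (boolP (v \in U)) => vU; rewrite ?andbF //= EE'.
apply: IH => x y; rewrite !finset.inE !negb_or => /andP[_ xU] /andP[_ yU].
exact: EE'.
Qed.

Definition marks (X : {set 'I_n * 'I_n}) (t j : nat) (v : 'I_n) : nat :=
  #|[set i : 'I_n | (t <= i < j)%N && ((i, v) \in X)]|.

Definition stops (m t : nat) (c : {ffun 'I_n -> nat}) (X : {set 'I_n * 'I_n}) : bool :=
  [exists j : 'I_m, (t <= j)%N &&
    (#|A| + #|[set v | (v \notin A) && (r <= c v + marks X t j v)]| <= j)%N].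

Lemma stops_step m (t : 'I_n) (U N : {set 'I_n}) u (c : {ffun 'I_n -> nat}) X :
  u |: U \subset infected c -> N \subset ~: (u |: U) ->
  stops m t.+1 (add_marks c N) X ->
  stops m t c (X :\: (pair t) @: (~: (u |: U)) :|: (pair t) @: N).
Proof.
set W := ~: (u |: U) => sU sN /existsP[j /andP[tj jA]].
apply/existsP; exists j; rewrite (ltnW tj) /=; apply: leq_trans jA.
rewrite leq_add2l; apply: subset_leq_card; apply/fintype.subsetP => v.
rewrite !finset.inE => /andP[vA]; rewrite vA /= ffunE.
have [vW|vW] := boolP (v \in W); last first.
  have : v \in infected c.
    by apply: (fintype.subsetP sU); move: vW; rewrite /W finset.inE negbK.
  rewrite !finset.inE (negbTE vA) /= => rc _; apply: leq_trans rc _.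
  by rewrite -addnA leq_addr.
set X' := (_ :|: _) => H; apply: leq_trans H _; rewrite -addnA leq_add2l.
have tX' : ((t, v) \in X') = (v \in N).
  rewrite /X' !finset.inE (imset_f (pair t) vW) /=.
  apply/imsetP/idP => [[w wN [->]]//|vN]; by exists v.
have iX' i : i != t -> ((i, v) \in X') = ((i, v) \in X).
  move=> it; rewrite /X' !finset.inE.
  have nim (B : {set 'I_n}) : (i, v) \notin (pair t) @: B.
    by apply/imsetP => -[w _ [ei _]]; rewrite ei eqxx in it.
  by rewrite (nim W) (negbTE (nim N)) orbF.
clearbody X'; rewrite /marks (cardsD1 t) finset.in_set tX' leqnn tj /= leq_add2l.
apply: subset_leq_card; apply/fintype.subsetP => i.
rewrite finset.in_setD1 !finset.in_set => /andP[it /andP[/andP[ti ij] iX]].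
by rewrite ij -iX' // iX !andbT ltn_neqAle ti andbT eq_sym.
Qed.

Context {R : realType} (p : R).
Hypothesis p01 : 0 <= p <= 1.

Lemma explore_le_stops (m k : nat) (U : {set 'I_n}) (c : {ffun 'I_n -> nat}) : (m <= n)%N -> (k + #|U| = n)%N ->
  A \subset infected c -> U \subset infected c ->
  bern_exp (complete_edges n) p (fun E => (#|explore k E U c| < m)%N%:R) <=
  bern_exp [set: 'I_n * 'I_n] p (fun X => (stops m #|U| c X)%:R).
Proof.
move=> mn; elim: k U c => [|k IH] U c kU sA sU.
  apply: (@le_trans _ _ (bern_exp (complete_edges n) p (fun=> 0))).
    by apply: bern_exp_le => // E _ /=; rewrite -[#|U|]add0n kU ltnNge mn.
  rewrite /bern_exp big1; last by move=> *; rewrite mulr0.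
  by apply: sumr_ge0 => X _; rewrite mulr_ge0 ?bern_weight_ge0.
rewrite /=; case: pickP => [u|none]; last first.
  have IU : infected c = U.
    apply/eqP; rewrite finset.eqEsubset sU andbT.
    apply/fintype.subsetP => v vI; move: (none v); rewrite finset.inE vI andbT.
    by move/negbFE.
  apply: (@le_trans _ _ (#|U| < m)%N%:R).
    rewrite -[leRHS]mulr1 -(bern_exp1 p (complete_edges n)).
    rewrite /bern_exp mulr_sumr; apply: ler_sum => E _.
    by rewrite mulr1 mulrC.
  case: (ltnP #|U| m) => [Um|_]; last first.
    by apply: sumr_ge0 => X _; rewrite mulr_ge0 ?bern_weight_ge0.
  apply: (@le_trans _ _ (bern_exp [set: 'I_n * 'I_n] p (fun=> 1))).
    by rewrite bern_exp1.
  apply: bern_exp_le => // X _.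
  suff -> : stops m #|U| c X.
    exact: lexx.
  apply/existsP; exists (Ordinal Um); rewrite /= leqnn /= -[leqRHS]/(#|U|) -IU.
  have -> : [set v | (v \notin A) && (r <= c v + marks X #|infected c| #|infected c| v)%N]
      = [set v | (r <= c v)%N] :\: A.
    apply/finset.setP => v; rewrite !finset.inE.
    rewrite /marks (_ : [set _ | _] = finset.set0) ?cards0 ?addn0 //.
    by apply/finset.setP => i; rewrite !finset.inE; case: ltnP; rewrite ?andbF // leqNgt => ->.
  rewrite -cardsUI (_ : A :&: _ = finset.set0) ?cards0 ?addn0; last first.
    by apply/finset.setP => v; rewrite !finset.inE; case: (v \in A).
  apply: subset_leq_card; apply/fintype.subsetP => v.
  by rewrite !finset.inE => /orP[->//|/andP[_ ->]]; rewrite orbT.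
rewrite finset.inE => /andP[uU uI].
have sU' : u |: U \subset infected c.
  by rewrite finset.subUset finset.sub1set uI sU.
set W := ~: (u |: U).
have cU : #|u |: U| = #|U|.+1 by rewrite cardsU1 uU.
have Un : (#|U| < n)%N by rewrite -[X in (_ < X)%N]kU addSn ltnS leq_addl.
pose j v : {set 'I_n} := [set u; v].
have jW : {in W &, injective j}.
  move=> x y; rewrite !finset.inE !negb_or => /andP[xu _] /andP[yu _].
  move/finset.setP/(_ x); rewrite !finset.inE eqxx orbT (negbTE xu) /=.
  by move=> /esym/eqP.
have jD : j @: W \subset complete_edges n.
  apply/fintype.subsetP => e /imsetP[v vW ->]; rewrite finset.inE cards2.
  by move: vW; rewrite !finset.inE negb_or eq_sym => /andP[->].
rewrite (bern_exp_resample p _ jW jD).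
have tW : {in W &, injective (pair (Ordinal Un))} by move=> x y _ _ [].
rewrite (bern_exp_resample p _ tW (finset.subsetT _)).
apply: bern_exp_le => // N sN.
have inj E v : v \in W -> ([set u; v] \in E :\: j @: W :|: j @: N) = (v \in N).
  move=> vW; rewrite finset.in_setU finset.in_setD (imset_f j vW) /=.
  apply/imsetP/idP => [[w wN /jW ->]//|vN]; last by exists v.
  exact: (fintype.subsetP sN).
have iff x y E : x \notin u |: U -> y \notin u |: U ->
    ([set x; y] \in E :\: j @: W :|: j @: N) = ([set x; y] \in E).
  rewrite !finset.in_setU1 !negb_or => /andP[xu _] /andP[yu _].
  have nim (B : {set 'I_n}) : [set x; y] \notin j @: B.
    apply/imsetP => -[w _ /finset.setP/(_ u)]; rewrite !finset.inE eqxx /=.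
    by rewrite eq_sym (negbTE xu) eq_sym (negbTE yu).
  by rewrite finset.in_setU finset.in_setD (nim W) (negbTE (nim N)) orbF.
apply: (@le_trans _ _ (bern_exp (complete_edges n) p
    (fun E => (#|explore k E (u |: U) (add_marks c N)| < m)%N%:R))).
  apply: bern_exp_le => // E _.
  rewrite (_ : [set v in W | _] = N); last first.
    apply/finset.setP => v; rewrite finset.in_set.
    case: (boolP (v \in W)) => [vW|vW] /=; first exact: inj.
    by apply/esym/negbTE; apply: contra vW; exact: (fintype.subsetP sN).
  by rewrite (@eq_explore _ _ E) // => x y xU yU; rewrite iff.
have sc : infected c \subset infected (add_marks c N).
  apply: finset.setUS; apply/fintype.subsetP => v; rewrite !finset.inE ffunE.
  by move=> rc; apply: leq_trans rc (leq_addr _ _).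
apply: le_trans (IH _ _ _ _ _) _.
- by rewrite cU addnS -addSn.
- exact: fintype.subset_trans sA sc.
- exact: fintype.subset_trans sU' sc.
rewrite cU; apply: bern_exp_le => // X _.
have := @stops_step m (Ordinal Un) U N u c X sU' sN.
by rewrite -/W /=; case: stops => [->//|_]; rewrite ler0n.
Qed.

Lemma bootstrap_le_stops (m : nat) : (m <= n)%N ->
  bern_exp (complete_edges n) p (fun E => (#|bootstrap_final r E A| < m)%N%:R) <=
  bern_exp [set: 'I_n * 'I_n] p (fun X => (stops m 0 [ffun=> 0%N] X)%:R).
Proof.
move=> mn.
have := @explore_le_stops m n finset.set0 [ffun=> 0%N] mn.
rewrite cards0 addn0 => /(_ erefl (finset.subsetUl _ _) (finset.sub0set _)).
apply: le_trans; apply: bern_exp_le => // E _; rewrite ler_nat.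
apply: (@leq_trans (#|explore n E finset.set0 [ffun=> 0%N]| < m)%N) => //.
have : explore n E finset.set0 [ffun=> 0%N] \subset bootstrap_final r E A.
  apply: explore_sub; rewrite ?finset.sub0set ?bootstrap_final_stable //.
    suff H i : A \subset iter i (bootstrap_round r E) A by exact: H.
    elim: i => [//|i IH]; rewrite iterS; apply: fintype.subset_trans IH (finset.subsetUl _ _).
  by move=> v; rewrite ffunE.
move=> /subset_leq_card le; case: ltnP => // lt.
by rewrite (leq_ltn_trans le lt).
Qed.
End Exploration.

(** * A maximal inequality for normalized counts *)

Section ProductExpectation.
Context {R : realType} {I O : finType} (nu : O -> R).

Definition prod_exp (f : {ffun I -> O} -> R) : R :=
  \sum_(w : {ffun I -> O}) (\prod_i nu (w i)) * f w.

Definition upd (w : {ffun I -> O}) (i : I) (x : O) : {ffun I -> O} :=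
  [ffun k => if k == i then x else w k].

Lemma prod_exp_prod (F : I -> O -> R) :
  prod_exp (fun w => \prod_i F i (w i)) = \prod_i \sum_x nu x * F i x.
Proof.
rewrite bigA_distr_bigA /=; apply: eq_bigr => w _.
by rewrite -big_split.
Qed.

Lemma prod_expD f g : prod_exp (fun w => f w + g w) = prod_exp f + prod_exp g.
Proof. by rewrite -big_split; apply: eq_bigr => w _; rewrite mulrDr. Qed.

Lemma prod_expZ a f : prod_exp (fun w => a * f w) = a * prod_exp f.
Proof. by rewrite /prod_exp mulr_sumr; apply: eq_bigr => w _; rewrite mulrCA. Qed.

Lemma prod_exp_sum (K : Type) (s : seq K) (P : pred K) (F : K -> {ffun I -> O} -> R) :
  prod_exp (fun w => \sum_(k <- s | P k) F k w) = \sum_(k <- s | P k) prod_exp (F k).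
Proof. by rewrite exchange_big; apply: eq_bigr => w _; rewrite mulr_sumr. Qed.

Lemma eq_prod_exp f g : f =1 g -> prod_exp f = prod_exp g.
Proof. by move=> fg; apply: eq_bigr => w _; rewrite fg. Qed.

Hypothesis nu1 : \sum_x nu x = 1.

(* (w, x) |-> (upd w i x, w i) is a weight-preserving involution. *)
Lemma prod_exp_resample (i : I) f :
  prod_exp f = prod_exp (fun w => \sum_x nu x * f (upd w i x)).
Proof.
pose sw (y : {ffun I -> O} * O) := (upd y.1 i y.2, y.1 i).
have swK y : sw (sw y) = y.
  case: y => w x; rewrite /sw /= ffunE eqxx; congr (_, _).
  by apply/ffunP => k; rewrite !ffunE; case: eqP => // ->.
transitivity (\sum_(y : {ffun I -> O} * O) (\prod_j nu (y.1 j)) * nu y.2 * f y.1).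
  rewrite -(pair_big predT predT
    (fun (w : {ffun I -> O}) x => (\prod_j nu (w j)) * nu x * f w)) /=.
  apply: eq_bigr => w _; rewrite -[LHS]mulr1 -[X in _ * X = _]nu1 mulr_sumr.
  by apply: eq_bigr => x _; rewrite mulrAC.
rewrite (reindex_inj (can_inj swK)) /=.
transitivity (\sum_(y : {ffun I -> O} * O) (\prod_j nu (y.1 j)) * nu y.2 * f (sw y).1).
  apply: eq_bigr => -[w x] _ /=; congr (_ * _).
  rewrite (bigD1 i) //= [in RHS](bigD1 i) //= ffunE eqxx mulrAC [RHS]mulrAC.
  rewrite [nu x * _]mulrC; congr (_ * _); apply: eq_bigr => k ki.
  by rewrite ffunE (negbTE ki).
rewrite -(pair_big predT predT
    (fun (w : {ffun I -> O}) x => (\prod_j nu (w j)) * nu x * f (sw (w, x)).1)) /=.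
apply: eq_bigr => w _; rewrite mulr_sumr; apply: eq_bigr => x _.
by rewrite -mulrA.
Qed.

Hypothesis nu0 : forall x, 0 <= nu x.

Lemma prod_exp_le f g : (forall w, f w <= g w) -> prod_exp f <= prod_exp g.
Proof. by move=> fg; apply: ler_sum => w _; rewrite ler_wpM2l ?prodr_ge0. Qed.

Context (B : nat -> pred O) (k : nat) (J : {set I}).
Let b s := \sum_(x | B s x) nu x.
Hypothesis Bdecr : forall s x, (s < k)%N -> B s.+1 x -> B s x.
Hypothesis b_gt0 : forall s, (s <= k)%N -> 0 < b s.

Definition normalized_count (s : nat) (w : {ffun I -> O}) : R :=
  \sum_(i in J) (B s (w i))%:R / b s.
Local Notation Z := normalized_count.

Let B_le s s' x : (s <= s')%N -> (s' <= k)%N -> B s' x -> B s x.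
Proof.
elim: s' => [|s' IH]; first by rewrite leqn0 => /eqP ->.
rewrite leq_eqVlt => /orP[/eqP -> //|]; rewrite ltnS => ss' s'k /Bdecr -/(_ s'k).
by apply: IH => //; exact: ltnW.
Qed.

Lemma normalized_count_orthogonal (s : nat) (G : {ffun I -> O} -> R) :
  (s <= k)%N ->
  (forall w i x y, (forall s', (s' <= s)%N -> B s' x = B s' y) ->
     G (upd w i x) = G (upd w i y)) ->
  prod_exp (fun w => G w * (Z k w - Z s w)) = 0.
Proof.
move=> sk HG.
have E : (fun w => G w * (Z k w - Z s w)) =1
    (fun w => \sum_(i in J) G w * ((B k (w i))%:R / b k - (B s (w i))%:R / b s)).
  by move=> w; rewrite -mulr_sumr -sumrB.
rewrite (eq_prod_exp E) prod_exp_sum big1 // => i iJ.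
rewrite (prod_exp_resample i) /prod_exp big1 // => w _.
apply/eqP; rewrite mulf_eq0; apply/orP; right; apply/eqP.
have [x0 x0s] : exists x0, B s x0.
  apply/existsP; rewrite -[[exists _, _]]negbK; apply/negP => /existsPn nB.
  by have := b_gt0 sk; rewrite /b big1 ?ltxx // => x; rewrite (negbTE (nB x)).
under eq_bigr => x _.
  rewrite ffunE eqxx.
  have -> : G (upd w i x) * ((B k x)%:R / b k - (B s x)%:R / b s) =
            G (upd w i x0) * ((B k x)%:R / b k - (B s x)%:R / b s).
    have [xs|xs] := boolP (B s x).
      congr (_ * _); apply: HG => s' s's.
      by rewrite (B_le s's sk xs) (B_le s's sk x0s).
    suff -> : B k x = false by rewrite !mul0r subrr !mulr0.
    by apply/negbTE; apply: contra xs; exact: B_le.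
  rewrite mulrCA; over.
rewrite -mulr_sumr; apply/eqP; rewrite mulf_eq0; apply/orP; right; apply/eqP.
have sb s' : (s' <= k)%N -> \sum_x nu x * ((B s' x)%:R / b s') = 1.
  move=> /b_gt0 bs'; under eq_bigr do rewrite mulrA.
  rewrite -mulr_suml (_ : \sum_x _ = b s') ?divff ?gt_eqF //.
  rewrite /b [RHS]big_mkcond; apply: eq_bigr => x _.
  by case: (B s' x); rewrite ?mulr1 ?mulr0.
under eq_bigr do rewrite mulrBr.
by rewrite sumrB !sb // subrr.
Qed.

(* Doob's maximal inequality for the submartingale exp (mu Z_s), by first-passage
   decomposition; the tangent bound e^(x - y) >= 1 + x - y replaces Jensen. *)
Lemma normalized_count_maximal (mu c : R) :
  prod_exp (fun w => (has (fun s => c <= mu * Z s w) (iota 0 k.+1))%:R) <=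
  expR (- c) * (1 - b k + b k * expR (mu / b k)) ^+ #|J|.
Proof.
pose ex s w := has (fun s => c <= mu * Z s w) (iota 0 s).
pose fp s w : R := ((c <= mu * Z s w) && ~~ ex s w)%:R.
have exS m w : (ex m w)%:R = \sum_(s <- iota 0 m) fp s w.
  elim: m => [|m IH]; first by rewrite big_nil.
  rewrite -addn1 /ex iotaD big_cat /= -IH big_seq1 has_cat /= orbF /fp -/(ex m w).
  by rewrite add0n; case: (ex m w) => /=; rewrite ?andbF ?andbT ?addr0 ?add0r.
have -> : (1 - b k + b k * expR (mu / b k)) ^+ #|J| =
    prod_exp (fun w => expR (mu * Z k w)).
  transitivity (prod_exp (fun w =>
      \prod_i (if i \in J then expR (mu * ((B k (w i))%:R / b k)) else 1))).
    rewrite (prod_exp_prod (fun i x =>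
      if i \in J then expR (mu * ((B k x)%:R / b k)) else 1)) [RHS](bigID (mem J)) /= [X in _ = _ * X]big1 ?mulr1; last first.
      by move=> i /negbTE iJ; rewrite iJ; under eq_bigr do rewrite mulr1.
    rewrite (eq_bigr (fun=> 1 - b k + b k * expR (mu / b k))).
      by rewrite prodr_const.
    move=> i iJ; rewrite iJ (bigID (B k)) /= addrC; congr (_ + _).
      rewrite -nu1 [X in X - _](bigID (B k)) /= [X in X - _]addrC addrK.
      by apply: eq_bigr => x /negbTE ->; rewrite mul0r mulr0 expR0 mulr1.
    rewrite mulr_suml; apply: eq_bigr => x ->.
    by rewrite mul1r.
  apply: eq_prod_exp => w; rewrite /normalized_count mulr_sumr expR_sum.
  by rewrite [RHS]big_mkcond.
rewrite expRN mulrC ler_pdivlMr ?expR_gt0 // mulrC -prod_expZ.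
have fpE s w : fp s w * expR (mu * Z s w) >= expR c * fp s w.
  rewrite /fp; case: (boolP (c <= _)) => /= [cs|_]; last by rewrite mul0r mulr0.
  by rewrite mulrC ler_wpM2l // ler_expR.
apply: (@le_trans _ _ (prod_exp (fun w => \sum_(s <- iota 0 k.+1) fp s w * expR (mu * Z s w)))).
  apply: prod_exp_le => w; rewrite -/(ex k.+1 w) exS mulr_sumr.
  by apply: ler_sum => s _; exact: fpE.
apply: (@le_trans _ _ (prod_exp (fun w => \sum_(s <- iota 0 k.+1) fp s w * expR (mu * Z k w)))); last first.
  apply: prod_exp_le => w; rewrite -mulr_suml -exS.
  by rewrite ler_piMl ?expR_ge0 // lern1 leq_b1.
rewrite !prod_exp_sum [leLHS]big_seq [leRHS]big_seq; apply: ler_sum => s.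
rewrite mem_iota add0n /= ltnS => sk.
have Zeq s' w i x y : (s' <= s)%N -> (forall s', (s' <= s)%N -> B s' x = B s' y) ->
    Z s' (upd w i x) = Z s' (upd w i y).
  move=> s's Bxy; apply: eq_bigr => i' _; rewrite !ffunE; case: eqP => // _.
  by rewrite Bxy.
have orth := @normalized_count_orthogonal s
  (fun w => mu * (fp s w * expR (mu * Z s w))) sk.
rewrite -[leLHS]addr0 -[X in _ + X <= _]orth; last first.
  move=> w i x y Bxy; rewrite (Zeq s _ _ _ _ (leqnn s) Bxy) /fp.
  rewrite (Zeq s _ _ _ _ (leqnn s) Bxy).
  have -> : ex s (upd w i x) = ex s (upd w i y).
    apply: eq_in_has => s'; rewrite mem_iota add0n /= => /ltnW s's.
    by rewrite (Zeq s' _ _ _ _ s's Bxy).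
  by [].
rewrite -prod_expD; apply: prod_exp_le => w.
have fp0 : 0 <= fp s w by rewrite ler0n.
have -> : mu * Z k w = mu * Z s w + mu * (Z k w - Z s w) by ring.
rewrite expRD.
have := @expR_ge1Dx R (mu * (Z k w - Z s w)).
have := expR_ge0 (mu * Z s w).
set e := expR (mu * Z s w); set e' := expR _; set d := Z k w - _ => e0 d1.
have : 0 <= fp s w * e * (e' - (1 + mu * d)) by rewrite !mulr_ge0 // subr_ge0.
lra.
Qed.
End ProductExpectation.

(** * The binomial tail *)

Lemma expRN_le_quadratic (R : realType) (x : R) : 0 <= x ->
  expR (- x) <= 1 - x + x ^+ 2 / 2.
Proof.
rewrite le_eqVlt => /orP[/eqP <-|x0].
  by rewrite oppr0 expR0 expr0n /= mul0r !addr0.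
pose g (y : R) := expR (- y) + y - y ^+ 2 / 2.
have dg (y : R) : is_derive y 1 g (- expR (- y) + 1 - y).
  rewrite /g; apply: is_derive_eq; rewrite /GRing.scale /=; lra.
have [|c] := @MVT R g (fun y => - expR (- y) + 1 - y) 0 x x0 (fun y _ => dg y).
  by apply: derivable_within_continuous => y _; have := dg y; case.
rewrite in_itv /= => /andP[c0 cx].
have g0 : g 0 = 1 by rewrite /g expr0n /= oppr0 expR0; lra.
rewrite g0 subr0 /g => gE.
have := @expR_ge1Dx R (- c) => ec.
have : (- expR (- c) + 1 - c) * x <= 0 by rewrite mulr_le0_ge0 ?(ltW x0) //; lra.
by rewrite -gE; lra.
Qed.

Section PiHat.
Context {R : realType} (p : R).
Hypothesis p01 : 0 <= p <= 1.

Lemma binomial_pmf0 j : binomial_pmf 0 p j = (j == 0%N)%:R.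
Proof.
by rewrite /binomial_pmf; case: j => [|j]; rewrite ?expr0 ?mulr1 // bin0n.
Qed.

Lemma binomial_pmfS0 t : binomial_pmf t.+1 p 0 = (1 - p) * binomial_pmf t p 0.
Proof. by rewrite /binomial_pmf !bin0 !subn0 !expr0 !mul1r exprS. Qed.

Lemma binomial_pmfSS t j : binomial_pmf t.+1 p j.+1 =
  p * binomial_pmf t p j + (1 - p) * binomial_pmf t p j.+1.
Proof.
rewrite /binomial_pmf binS subSS addnC mulrnDr; congr (_ + _).
  by rewrite -mulrnAr mulrA -exprS mulrnAr.
have [jt|tj] := ltnP j t; last by rewrite bin_small // !mulr0n mulr0.
by rewrite /unstable.onem -(subnSK jt) [(1 - p) ^+ _]exprS mulrnAr mulrCA.
Qed.

Lemma pi_hatE r t : pi_hat r p t = 1 - \sum_(j < r) binomial_pmf t p j.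
Proof.
rewrite /pi_hat.
have -> : [set k | (r <= k)%N]%classic = (~` `I_r)%classic.
  by apply/seteqP; split => k /=; [rewrite leqNgt => /negP|move/negP; rewrite -leqNgt].
rewrite (probability_setC (@binomial_prob R t p)) //.
rewrite /= /binomial_prob p01 /= esum_fset //=; last first.
  by move=> k _; rewrite lee_fin binomial_pmf_ge0.
by rewrite -fsbig_ord /= sumEFin.
Qed.

Lemma pi_hat_lt1E r t : 1 - pi_hat r p t = \sum_(j < r) binomial_pmf t p j.
Proof. by rewrite pi_hatE; lra. Qed.

Lemma pi_hat_le1 r t : pi_hat r p t <= 1.
Proof.
by rewrite -subr_ge0 pi_hat_lt1E; apply: sumr_ge0 => j _; exact: binomial_pmf_ge0.
Qed.

Lemma pi_hatS r t : pi_hat r.+1 p t.+1 = pi_hat r.+1 p t + p * binomial_pmf t p r.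
Proof.
rewrite !pi_hatE.
suff : \sum_(j < r.+1) binomial_pmf t.+1 p j =
       \sum_(j < r.+1) binomial_pmf t p j - p * binomial_pmf t p r by lra.
elim: r => [|r IH]; first by rewrite !big_ord1 binomial_pmfS0; lra.
rewrite big_ord_recr /= IH [in RHS]big_ord_recr /= binomial_pmfSS; lra.
Qed.

Lemma pi_hat0 r : pi_hat r.+1 p 0 = 0.
Proof.
rewrite pi_hatE big_ord_recl /= big1 ?binomial_pmf0; first by rewrite addr0 subrr.
by move=> i _; rewrite binomial_pmf0.
Qed.

Lemma pi_hat_nondecr r s t : (s <= t)%N -> pi_hat r.+1 p s <= pi_hat r.+1 p t.
Proof.
elim: t => [|t IH]; first by rewrite leqn0 => /eqP ->.
rewrite leq_eqVlt => /orP[/eqP -> //|]; rewrite ltnS => /IH st.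
apply: le_trans st _; rewrite pi_hatS lerDl mulr_ge0 ?binomial_pmf_ge0 //.
by case/andP: p01.
Qed.

Lemma pi_hat_ge0 r t : 0 <= pi_hat r.+1 p t.
Proof. by rewrite -(pi_hat0 r); exact: pi_hat_nondecr. Qed.

Lemma bern_exp_set1 (T : finType) (x : T) (f : {set T} -> R) :
  bern_exp [set x] p f = p * f [set x] + (1 - p) * f finset.set0.
Proof.
rewrite /bern_exp (bigD1 [set x]) ?fintype.subxx //=; congr (_ + _).
  by rewrite /bern_weight big_set1 finset.set11.
rewrite (bigD1 finset.set0) /=; last first.
  by rewrite finset.sub0set eq_sym -finset.card_gt0 cards1.
rewrite big1 ?addr0; first by rewrite /bern_weight big_set1 finset.inE.
move=> E /andP[/andP[]]; rewrite subset1 => /orP[/eqP ->|/eqP ->];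
  by rewrite ?eqxx ?andbF.
Qed.

Definition early {n : nat} (c : {set 'I_n}) (t : nat) : nat :=
  #|[set i in c | (i < t)%N]|.

Lemma early_nondecr n (c : {set 'I_n}) s t : (s <= t)%N -> (early c s <= early c t)%N.
Proof.
move=> st; apply: subset_leq_card; apply/fintype.subsetP => i.
by rewrite !finset.inE => /andP[-> /leq_trans]; exact.
Qed.

Lemma early_law n t j : (t <= n)%N ->
  bern_exp [set: 'I_n] p (fun c => (early c t == j)%:R) = binomial_pmf t p j.
Proof.
elim: t j => [|t IH] j tn.
  rewrite binomial_pmf0 -[RHS]mulr1 -[X in _ = _ * X](bern_exp1 p [set: 'I_n]).
  rewrite /bern_exp mulr_sumr; apply: eq_bigr => c _; rewrite mulr1 mulrC.
  congr (_%:R * _); rewrite /early (_ : [set _ in _ | _] = finset.set0) ?cards0 1?eq_sym //.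
  by apply/finset.setP => i; rewrite !finset.inE ltn0 andbF.
pose W := [set Ordinal tn].
have idW : {in W &, injective (@id 'I_n)} by move=> x y.
rewrite (bern_exp_resample p _ idW (finset.subsetT _)) bern_exp_set1.
have E (c : {set 'I_n}) (N : {set 'I_n}) : N \subset W ->
    early (c :\: id @: W :|: id @: N) t.+1 = ((Ordinal tn \in N) + early c t)%N.
  rewrite !imset_id => sN; rewrite /early (cardsD1 (Ordinal tn)) !finset.inE /= ltnSn eqxx /= andbT.
  congr (_ + _)%N; apply: eq_card => i; rewrite !finset.inE ltnS.
  rewrite ltn_neqAle -val_eqE /=; case: (altP (_ =P _)) => it; rewrite ?andbF //=.
  suff -> : i \in N = false by rewrite orbF.
  apply/negbTE/negP => /(fintype.subsetP sN); rewrite finset.inE -val_eqE /=.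
  by rewrite (negbTE it).
rewrite (eq_bern_exp p (g := fun c : {set 'I_n} => ((early c t).+1 == j)%:R)); last first.
  by move=> c _; rewrite E // finset.set11.
rewrite [X in _ + _ * X](eq_bern_exp p (g := fun c : {set 'I_n} => (early c t == j)%:R)); last first.
  by move=> c _; rewrite E ?finset.sub0set // finset.inE add0n.
case: j => [|j]; last by rewrite binomial_pmfSS -!IH // ltnW.
rewrite binomial_pmfS0 IH ?(ltnW tn) // [X in p * X]/bern_exp.
by rewrite big1 ?mulr0 ?add0r // => c _; rewrite mulr0.
Qed.

Lemma early_lt_law n r t : (t <= n)%N ->
  \sum_(c : {set 'I_n} | (early c t < r)%N) bern_weight [set: 'I_n] p c =
  1 - pi_hat r p t.
Proof.
move=> tn; rewrite pi_hat_lt1E.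
under [RHS]eq_bigr do rewrite -(early_law _ tn).
rewrite exchange_big /= [LHS]big_mkcond /=; apply: eq_big => [c|c _].
  by rewrite finset.subsetT.
rewrite -mulr_sumr; case: ifP => [cr|cr].
  rewrite (bigD1 (Ordinal cr)) //= eqxx big1 ?addr0 ?mulr1 //.
  by move=> i; rewrite -val_eqE /= eq_sym => /negbTE ->.
rewrite big1 ?mulr0 // => i _; case: eqP => // ci.
by move: (ltn_ord i); rewrite -ci cr.
Qed.

Lemma early_ge_law n r t : (t <= n)%N ->
  \sum_(c : {set 'I_n} | (r <= early c t)%N) bern_weight [set: 'I_n] p c =
  pi_hat r p t.
Proof.
move=> tn; have := bern_exp1 p [set: 'I_n]; rewrite /bern_exp.
rewrite (eq_bigl xpredT) => [|c]; last by rewrite finset.subsetT.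
under eq_bigr do rewrite mulr1.
rewrite (bigID (fun c : {set 'I_n} => (early c t < r)%N)) /= early_lt_law //.
under [X in _ + X]eq_bigl do rewrite -leqNgt.
lra.
Qed.

End PiHat.

(** * Failure bounds for independent marks *)

Lemma bern_exp_columns (R : realType) (n : nat) (p : R)
    (f : {set 'I_n * 'I_n} -> R) :
  bern_exp [set: 'I_n * 'I_n] p f =
  prod_exp (I := 'I_n) (bern_weight [set: 'I_n] p) (fun w => f [set y | y.1 \in w y.2]).
Proof.
rewrite /bern_exp (eq_bigl xpredT) => [|X]; last by rewrite finset.subsetT.
pose h (w : {ffun 'I_n -> {set 'I_n}}) := [set y : 'I_n * 'I_n | y.1 \in w y.2].
pose g (X : {set 'I_n * 'I_n}) : {ffun 'I_n -> {set 'I_n}} :=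
  [ffun v => [set i | (i, v) \in X]].
have hg : cancel g h.
  by move=> X; apply/finset.setP => -[i v]; rewrite finset.inE ffunE finset.inE.
have gh : cancel h g.
  by move=> w; apply/ffunP => v; apply/finset.setP => i; rewrite ffunE !finset.inE.
rewrite (reindex h) /=; last by apply: onW_bij; exists g.
apply: eq_bigr => w _; congr (_ * _); rewrite /bern_weight.
rewrite (eq_bigl xpredT) => [|y]; last by rewrite finset.inE.
rewrite (eq_bigr (fun y => if y.1 \in w y.2 then p else 1 - p)); last first.
  by move=> y _; rewrite finset.inE.
rewrite -(pair_bigA _ (fun i v => if i \in w v then p else 1 - p)) exchange_big /=.
by apply: eq_bigr => v _; apply: eq_bigl => i; rewrite finset.inE.
Qed.

Section IndependentMarks.
Context {R : realType} {n : nat} (r : nat) (p : R) (A : {set 'I_n}).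
Hypothesis p01 : 0 <= p <= 1.
Local Notation nu := (bern_weight [set: 'I_n] p).
Local Notation pi := (pi_hat r.+1 p).
Local Notation N := (#|~: A|%:R : R).

Definition active (w : {ffun 'I_n -> {set 'I_n}}) (t : nat) : nat :=
  #|[set v | (v \notin A) && (r.+1 <= early (w v) t)%N]|.

Let nu1 : \sum_(c : {set 'I_n}) nu c = 1.
Proof.
have := bern_exp1 p [set: 'I_n]; rewrite /bern_exp.
rewrite (eq_bigl xpredT) => [|c]; last by rewrite finset.subsetT.
by under eq_bigr do rewrite mulr1.
Qed.

Let nu0 (c : {set 'I_n}) : 0 <= nu c. Proof. exact: bern_weight_ge0. Qed.

Lemma active_compl (w : {ffun 'I_n -> {set 'I_n}}) t :
  (\sum_(v in ~: A) (early (w v) t < r.+1)%N%:R : R) = N - (active w t)%:R.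
Proof.
rewrite -natr_sum -natrB; last first.
  by apply: subset_leq_card; apply/fintype.subsetP => v; rewrite !finset.inE => /andP[].
congr _%:R; rewrite -(cardsID [set v | (r.+1 <= early (w v) t)%N] (~: A)).
have -> : ~: A :&: [set v | (r.+1 <= early (w v) t)%N] =
    [set v | (v \notin A) && (r.+1 <= early (w v) t)%N].
  by apply/finset.setP => v; rewrite !finset.inE.
rewrite /active addKn -sum1_card [RHS]big_mkcond [LHS]big_mkcond.
apply: eq_bigr => v _; rewrite !finset.inE -ltnNge andbC.
by case: (v \in A); rewrite ?andbF //= andbT; case: ifP.
Qed.

Lemma active_sum (w : {ffun 'I_n -> {set 'I_n}}) t :
  (\sum_(v in ~: A) (r.+1 <= early (w v) t)%N%:R : R) = (active w t)%:R.
Proof.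
rewrite -natr_sum; congr _%:R; rewrite /active -sum1_card.
rewrite [RHS]big_mkcond [LHS]big_mkcond.
apply: eq_bigr => v _; rewrite !finset.inE.
by case: (v \in A) => //=; case: ifP.
Qed.

Lemma forward_bound (k : nat) (x lam : R) : (k <= n)%N -> 0 <= lam ->
  pi k < 1 ->
  prod_exp nu (fun w => (has (fun t =>
    (1 - pi t) * (N + x) <= N - (active w t)%:R) (iota 0 k.+1))%:R) <=
  expR (N * pi k * lam ^+ 2 / 2 - lam * (1 - pi k) * x).
Proof.
move=> kn lam0 pik.
pose B s (c : {set 'I_n}) := (early c s < r.+1)%N.
have bE s : (s <= k)%N -> \sum_(c | B s c) nu c = 1 - pi s.
  by move=> sk; rewrite early_lt_law // (leq_trans sk).
have b0 s : (s <= k)%N -> 0 < \sum_(c | B s c) nu c.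
  move=> sk; rewrite bE // subr_gt0; apply: le_lt_trans pik.
  exact: pi_hat_nondecr.
have Bd s (c : {set 'I_n}) : (s < k)%N -> B s.+1 c -> B s c.
  by move=> _; apply: leq_ltn_trans; exact: early_nondecr.
have := @normalized_count_maximal R 'I_n {set 'I_n} nu nu1 nu0 B k (~: A) Bd b0
  (lam * (1 - pi k)) (lam * (1 - pi k) * (N + x)).
rewrite bE // mulfK; last by rewrite gt_eqF // subr_gt0.
move=> H; apply: le_trans; last apply: le_trans H _.
  apply: prod_exp_le => // w; rewrite ler_nat.
  case: hasP => // -[s sk Hs]; rewrite lt0b; apply/hasP; exists s => //.
  move: sk; rewrite mem_iota add0n /= ltnS => sk.
  rewrite /normalized_count bE // -mulr_suml active_compl.
  have bs := b0 _ sk; rewrite bE // in bs.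
  rewrite ler_wpM2l ?mulr_ge0 ?subr_ge0 ?(ltW pik) //.
  by rewrite ler_pdivlMr // mulrC.
set q := pi k.
have q0 : 0 <= q by exact: pi_hat_ge0.
have base : 1 - (1 - q) + (1 - q) * expR lam <= expR (lam - q * lam + q * lam ^+ 2 / 2).
  have -> : 1 - (1 - q) + (1 - q) * expR lam = expR lam * (1 - q + q * expR (- lam)).
    by rewrite mulrDr mulrCA expRxMexpNx_1; ring.
  have -> : lam - q * lam + q * lam ^+ 2 / 2 = lam + (- (q * (lam - lam ^+ 2 / 2))) by ring.
  rewrite expRD ler_wpM2l ?expR_ge0 //; apply: le_trans (expR_ge1Dx _).
  have := expRN_le_quadratic lam0 => /(ler_wpM2l q0); lra.
apply: (@le_trans _ _ (expR (- (lam * (1 - q) * (N + x))) *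
    expR (lam - q * lam + q * lam ^+ 2 / 2) ^+ #|~: A|)).
  rewrite ler_wpM2l ?expR_ge0 // lerXn2r // nnegrE ?expR_ge0 //.
  by rewrite addr_ge0 ?mulr_ge0 ?expR_ge0 // ?subr_ge0 ?(ltW pik) //; lra.
by rewrite -expRM_natl -expRD ler_expR; lra.
Qed.

Lemma reverse_bound (t1 T : nat) (eta : R) : (t1 <= T)%N -> (T <= n)%N ->
  0 <= eta -> 0 < pi t1 ->
  prod_exp nu (fun w => (has (fun t =>
    (active w t)%:R <= (1 - eta) * N * pi t) (index_iota t1 T.+1))%:R) <=
  expR (- (N * pi t1 * eta ^+ 2 / 2)).
Proof.
move=> t1T Tn eta0; set q := pi t1 => q0.
pose k := (T - t1)%N.
pose B s (c : {set 'I_n}) := (r.+1 <= early c (T - s))%N.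
have bE s : (s <= k)%N -> \sum_(c | B s c) nu c = pi (T - s).
  by move=> sk; rewrite early_ge_law // (leq_trans (leq_subr _ _)).
have ts s : (s <= k)%N -> (t1 <= T - s)%N by rewrite /k; lia.
have b0 s : (s <= k)%N -> 0 < \sum_(c | B s c) nu c.
  move=> sk; rewrite bE //; apply: lt_le_trans q0 _.
  by apply: pi_hat_nondecr => //; exact: ts.
have Bd s (c : {set 'I_n}) : (s < k)%N -> B s.+1 c -> B s c.
  by move=> _ /leq_trans; apply; apply: early_nondecr; lia.
have := @normalized_count_maximal R 'I_n {set 'I_n} nu nu1 nu0 B k (~: A) Bd b0
  (- eta * q) (- eta * q * ((1 - eta) * N)).
rewrite bE // subKn // mulfK ?gt_eqF // -/q.
move=> H; apply: le_trans; last apply: le_trans H _.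
  apply: prod_exp_le => // w; rewrite ler_nat.
  case: hasP => // -[t]; rewrite mem_index_iota ltnS => /andP[tt tT] Ht.
  rewrite lt0b; apply/hasP; exists (T - t)%N.
    by rewrite mem_iota add0n /= ltnS /k; lia.
  have sk : (T - t <= k)%N by rewrite /k; lia.
  rewrite /normalized_count bE // -mulr_suml active_sum subKn //.
  have bs := b0 _ sk; rewrite bE // subKn // in bs.
  rewrite !mulNr lerN2 ler_wpM2l ?mulr_ge0 ?(ltW q0) //.
  by rewrite ler_pdivrMr.
have base : 1 - q + q * expR (- eta) <= expR (- q * (eta - eta ^+ 2 / 2)).
  apply: le_trans (expR_ge1Dx _).
  have := expRN_le_quadratic eta0 => /(ler_wpM2l (ltW q0)); lra.
apply: (@le_trans _ _ (expR (- (- eta * q * ((1 - eta) * N))) *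
    expR (- q * (eta - eta ^+ 2 / 2)) ^+ #|~: A|)).
  rewrite ler_wpM2l ?expR_ge0 // lerXn2r // nnegrE ?expR_ge0 //.
  by rewrite addr_ge0 ?mulr_ge0 ?expR_ge0 ?(ltW q0) // subr_ge0 pi_hat_le1.
by rewrite -expRM_natl -expRD ler_expR; lra.
Qed.

Lemma bootstrap_fail_bound (m k k2 : nat) (x lam eta1 eta2 : R) :
  (k <= k2)%N -> (k2 <= m)%N -> (m <= n)%N ->
  0 <= lam -> 0 <= eta1 -> 0 <= eta2 -> 0 < pi k -> pi k < 1 ->
  (forall t, (t <= k)%N -> t%:R <= n%:R - (1 - pi t) * (N + x)) ->
  (forall t, (k < t <= k2)%N -> t%:R <= #|A|%:R + (1 - eta1) * N * pi t) ->
  (forall t, (k2 < t < m)%N -> t%:R <= #|A|%:R + (1 - eta2) * N * pi t) ->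
  bern_exp (complete_edges n) p (fun E => (#|bootstrap_final r.+1 E A| < m)%N%:R) <=
  expR (N * pi k * lam ^+ 2 / 2 - lam * (1 - pi k) * x) +
  expR (- (N * pi k * eta1 ^+ 2 / 2)) + expR (- (N * pi k2 * eta2 ^+ 2 / 2)).
Proof.
move=> kk2 k2m mn lam0 e1 e2 pk0 pk1 H1 H2 H3.
have pk2 : 0 < pi k2 by apply: lt_le_trans pk0 _; exact: pi_hat_nondecr.
have k2n := leq_trans k2m mn.
have nE : n%:R = #|A|%:R + N :> R.
  by rewrite -natrD -[in LHS](card_ord n) -(cardsC A).
apply: le_trans (bootstrap_le_stops r.+1 A p01 mn) _; rewrite bern_exp_columns.
apply: le_trans; last first.
  apply: lerD (reverse_bound k2m mn e2 pk2).
  apply: lerD (reverse_bound kk2 k2n e1 pk0).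
  exact: (forward_bound x (leq_trans kk2 k2n) lam0 pk1).
rewrite -!prod_expD; apply: prod_exp_le => // w; rewrite -!natrD ler_nat.
case: (boolP (stops _ _ _ _ _ _)) => // /existsP[j /andP[_]].
have -> : [set v | (v \notin A) && (r < [ffun=> 0] v +
      marks [set y | y.1 \in w y.2] 0 j v)%N] =
    [set v | (v \notin A) && (r.+1 <= early (w v) j)%N].
  apply/finset.setP => v; rewrite !finset.inE ffunE add0n /marks /early.
  congr (_ && (_ < _)%N); apply: eq_card => i; rewrite !finset.inE /=.
  by rewrite andbC.
rewrite -/(active w j) => Hj.
have {}Hj : #|A|%:R + (active w j)%:R <= j%:R :> R by rewrite -natrD ler_nat.
have jm := ltn_ord j.
have [jk|kj] := leqP j k.
  have -> : has (fun t => (1 - pi t) * (N + x) <= N - (active w t)%:R) (iota 0 k.+1).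
    apply/hasP; exists (j : nat); first by rewrite mem_iota.
    by have := H1 _ jk; rewrite nE; lra.
  by rewrite -addnA leq_addr.
have [jk2|k2j] := leqP j k2.
  have -> : has (fun t => (active w t)%:R <= (1 - eta1) * N * pi t) (index_iota k k2.+1).
    apply/hasP; exists (j : nat); first by rewrite mem_index_iota (ltnW kj).
    by have := H2 j; rewrite kj jk2 => /(_ isT); lra.
  by rewrite -addnA addnCA leq_addr.
have -> : has (fun t => (active w t)%:R <= (1 - eta2) * N * pi t) (index_iota k2 m.+1).
  apply/hasP; exists (j : nat); first by rewrite mem_index_iota (ltnW k2j) ltnW.
  by have := H3 j; rewrite k2j jm => /(_ isT); lra.
by rewrite addnC leq_addr.
Qed.
End IndependentMarks.

Lemma bootstrap_prob_ge (R : realType) (n a : nat) (p F : R)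
    (Q : {set {set 'I_n}} -> {set 'I_n} -> bool) : (a <= n)%N ->
  (forall A : {set 'I_n}, #|A| = a ->
     bern_exp (complete_edges n) p (fun E => (~~ Q E A)%:R) <= F) ->
  1 - F <= bootstrap_prob p a Q.
Proof.
move=> an HF; rewrite /bootstrap_prob.
set M : R := _%:R.
have M0 : 0 < M.
  by rewrite ltr0n (card_draws 'I_n a) card_ord bin_gt0.
have -> : 1 - F = \sum_(A : {set 'I_n} | #|A| == a) (1 - F) / M.
  rewrite sumr_const -mulr_natr.
  have -> : #|[pred A : {set 'I_n} | #|A| == a]|%:R = M.
    by rewrite /M; congr _%:R; apply: eq_card => A; rewrite !finset.inE.
  by rewrite divfK // gt_eqF.
under [leRHS]eq_bigr do rewrite big_mkcondr.
rewrite exchange_big /=; apply: ler_sum => A /eqP Aa.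
rewrite -[leRHS]mulr1 -[X in _ <= _ * X](@mulVf _ M) ?gt_eqF // mulrA.
rewrite mulrAC ler_wpM2r ?invr_ge0 ?(ltW M0) //.
rewrite -(bern_exp1 p (complete_edges n)) lerBlDr.
apply: (@le_trans _ _ (\sum_(E : {set {set 'I_n}} | E \subset complete_edges n)
     (if Q E A then gnp_weight p E / M else 0) * M +
     bern_exp (complete_edges n) p (fun E => (~~ Q E A)%:R))); last first.
  by rewrite -mulr_suml lerD2l HF.
rewrite /bern_exp -big_split /=; apply: ler_sum => E _.
case: (Q E A) => /=; last by rewrite mul0r add0r.
by rewrite mulr0 addr0 divfK ?gt_eqF // mulr1.
Qed.

Section PiHatBounds.
Context {R : realType}.

Lemma bernoulli_ineq (x : R) m : 0 <= x <= 1 -> 1 - m%:R * x <= (1 - x) ^+ m.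
Proof.
case/andP=> x0 x1; elim: m => [|m IH]; first by rewrite expr0 mul0r subr0.
rewrite exprS -natr1.
apply: (@le_trans _ _ ((1 - x) * (1 - m%:R * x))); last by rewrite ler_wpM2l ?subr_ge0.
have : 0 <= m%:R * x * x by rewrite !mulr_ge0.
lra.
Qed.

Lemma ffact_ge (t m : nat) : ((t - m) ^ m <= t ^_ m)%N.
Proof.
elim: m t => [|m IH] t //; case: t => [|t]; first by rewrite sub0n exp0n.
rewrite ffactnS /= subSS expnS leq_mul // (leq_trans (leq_subr _ _)) //.
Qed.

Lemma ffact_le (t m : nat) : (t ^_ m <= t ^ m)%N.
Proof.
elim: m t => [|m IH] t //; case: t => [|t]; first by rewrite ffact0n.
rewrite ffactnS /= expnS leq_mul // (leq_trans (IH _)) //.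
by case: m {IH} => // m; rewrite leq_exp2r.
Qed.

Context (p : R).
Hypothesis p01 : 0 <= p <= 1.

Lemma binomial_pmf_lower (t m : nat) : (m <= t)%N -> t%:R * p <= 1 ->
  (1 - t%:R * p) * (p * (t%:R - m%:R)) ^+ m / m`!%:R <= binomial_pmf t p m.
Proof.
move=> mt tp1; have [p0 p1] := andP p01.
rewrite /binomial_pmf -[leRHS]mulr_natr.
have -> : ('C(t, m))%:R = (t ^_ m)%:R / m`!%:R :> R.
  by rewrite -bin_ffact natrM mulfK // pnatr_eq0 -lt0n fact_gt0.
rewrite mulrA ler_wpM2r ?invr_ge0 // exprMn mulrA -natrB //.
apply: ler_pM; rewrite ?exprn_ge0 ?mulr_ge0 ?subr_ge0 ?exprn_ge0 //; last first.
  by rewrite -natrX ler_nat ffact_ge.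
rewrite mulrC ler_wpM2l ?exprn_ge0 //.
apply: le_trans (bernoulli_ineq _ p01); rewrite lerB // ler_wpM2r //.
by rewrite ler_nat leq_subr.
Qed.

Lemma binomial_pmf_upper (t m : nat) : binomial_pmf t p m <= 'C(t, m)%:R * p ^+ m.
Proof.
have [p0 p1] := andP p01.
rewrite /binomial_pmf -[leLHS]mulr_natr mulrC ler_wpM2l // ler_piMr ?exprn_ge0 //.
by rewrite /unstable.onem exprn_ile1 //; lra.
Qed.

Lemma pi_hat_upper r t : pi_hat r.+1 p t <= (t%:R * p) ^+ r.+1 / (r.+1)`!%:R.
Proof.
have [p0 p1] := andP p01.
apply: (@le_trans _ _ ('C(t, r.+1)%:R * p ^+ r.+1)).
  elim: t => [|t IH]; first by rewrite pi_hat0 // bin0n mul0r.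
  rewrite pi_hatS // binS natrD mulrDl lerD // exprS mulrCA ler_wpM2l //.
  exact: binomial_pmf_upper.
rewrite exprMn mulrAC ler_wpM2r ?exprn_ge0 // ler_pdivlMr ?ltr0n ?fact_gt0 //.
by rewrite -natrM bin_ffact -natrX ler_nat ffact_le.
Qed.

Lemma pi_hat_ge_pmf r t : binomial_pmf t p r <= pi_hat r p t.
Proof.
have := pi_hat_le1 p01 r.+1 t; rewrite !pi_hatE // big_ord_recr /=.
have : 0 <= pi_hat r.+1 p t by exact: pi_hat_ge0.
by rewrite pi_hatE // big_ord_recr /=; lra.
Qed.

Lemma pi_hat_compl_upper r t :
  1 - pi_hat r p t <= 2 ^+ r * expR (- (t%:R * p / 2)).
Proof.
have [p0 p1] := andP p01.
pose G k u := \sum_(j < k) 2^-1 ^+ j * binomial_pmf u p j.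
have G0 k u : 0 <= G k u.
  by apply: sumr_ge0 => j _; rewrite mulr_ge0 ?exprn_ge0 ?binomial_pmf_ge0.
have Gr k u : G k.+1 u = G k u + 2^-1 ^+ k * binomial_pmf u p k.
  by rewrite /G big_ord_recr.
have GS k u : G k.+1 u.+1 = (1 - p) * G k.+1 u + p / 2 * G k u.
  elim: k => [|k IH].
    by rewrite /G !big_ord1 big_ord0 binomial_pmfS0 !expr0 !mul1r; lra.
  by rewrite (Gr k.+1 u.+1) IH (Gr k.+1 u) (Gr k u) binomial_pmfSS exprS; lra.
have Gle k u : G k.+1 u <= (1 - p / 2) ^+ u.
  elim: u => [|u IH].
    rewrite /G big_ord_recl big1 /= ?binomial_pmf0; first by rewrite !expr0 mul1r addr0.
    by move=> i _; rewrite binomial_pmf0 mulr0.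
  rewrite GS exprS.
  have : G k u <= G k.+1 u.
    by rewrite Gr lerDl mulr_ge0 ?exprn_ge0 ?binomial_pmf_ge0 //.
  move=> /(ler_wpM2l (divr_ge0 p0 (ler0n _ 2))).
  move: IH => /(ler_wpM2l (_ : 0 <= 1 - p / 2)) -/(_ ltac:(lra)); lra.
rewrite pi_hat_lt1E //.
apply: (@le_trans _ _ (2 ^+ r * G r t)).
  rewrite /G mulr_sumr; apply: ler_sum => j _; rewrite mulrA ler_peMl ?binomial_pmf_ge0 //.
  rewrite exprVn ler_pdivlMr ?exprn_gt0 // mul1r.
  by rewrite ler_eXn2l ?(ltr_nat _ 1) // ltnW.
rewrite ler_wpM2l ?exprn_ge0 //.
case: r => [|r]; first by rewrite /G big_ord0 expR_ge0.
apply: le_trans (Gle _ _) _.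
have -> : - (t%:R * p / 2) = t%:R * (- (p / 2)) by ring.
rewrite expRM_natl; apply: lerXn2r; rewrite ?nnegrE ?expR_ge0 //; first by lra.
by have := expR_ge1Dx (- (p / 2)); lra.
Qed.
End PiHatBounds.

(** * The barrier at a fixed n *)

(* Half a lower bound for [pi (1 / (200 p))]. *)
Definition linear_const {R : realType} (r : nat) : R := (400^-1 ^+ r / r`!%:R) / 4.

Lemma linear_const_bounds (R : realType) (r : nat) : 0 < @linear_const R r <= 2^-1.
Proof.
rewrite /linear_const; set b : R := 400^-1.
have b0 : 0 < b by rewrite invr_gt0 ltr0n.
have b1 : b <= 1 by rewrite invf_le1 ?ltr0n // ler1n.
have f0 : 0 < r`!%:R :> R by rewrite ltr0n fact_gt0.
have f1 : 1 <= r`!%:R :> R by rewrite ler1n fact_gt0.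
clearbody b; move: (r`!%:R : R) f0 f1 => f f0 f1.
have : b ^+ r / f <= 1.
  by rewrite ler_pdivrMr // mul1r (le_trans _ f1) // exprn_ile1 // ltW.
have : 0 < b ^+ r / f by rewrite divr_gt0 // exprn_gt0.
lra.
Qed.

Lemma bernoulli_ineq_pos (R : realType) (x : R) m : 0 <= x -> 1 + m%:R * x <= (1 + x) ^+ m.
Proof.
move=> x0; elim: m => [|m IH]; first by rewrite expr0 mul0r addr0.
rewrite exprS -natr1.
apply: (@le_trans _ _ ((1 + x) * (1 + m%:R * x))); last by rewrite ler_wpM2l // addr_ge0.
have : 0 <= m%:R * x * x by rewrite !mulr_ge0.
lra.
Qed.

Section Deterministic.
Context {R : realType} (s n a : nat) (p t0 dl al ac K : R).
Local Notation r := s.+1.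
Local Notation pi := (pi_hat r p).
Hypothesis s0 : (0 < s)%N.
Hypothesis p_gt0 : 0 < p.
Hypothesis p_le1 : p <= 1.
Hypothesis t0_gt0 : 0 < t0.
Hypothesis dl_gt0 : 0 < dl.
Hypothesis t0E : n%:R * p ^+ r * t0 ^+ s = (1 + dl) * s`!%:R.
Hypothesis dl_small : 100 * r%:R * dl <= 1.
Hypothesis t0_large : 100 * r%:R ^+ 2 <= dl * t0.
Hypothesis t0p_small : 100 * r%:R * (t0 * p) <= dl.
Hypothesis t0n_small : 100 * t0 <= dl * n%:R.
Hypothesis K_gt1 : 1 < K.
Hypothesis KE : K ^+ r = 4.
Hypothesis K_le : r%:R * K <= r%:R + 2.

Let p01 : 0 <= p <= 1. Proof. by rewrite (ltW p_gt0). Qed.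
Let r2 : 2 <= r%:R :> R. Proof. by rewrite (ler_nat _ 2). Qed.
Let n_gt0 : 0 < (n%:R : R).
Proof.
have : 0 < dl * n%:R by apply: lt_le_trans t0n_small; rewrite mulr_gt0.
by rewrite pmulr_rgt0.
Qed.
Let dl1 : dl <= 200^-1. Proof. have : 2 * dl <= r%:R * dl by rewrite ler_wpM2r // ltW. by move: dl_small; lra. Qed.
Let rr : r%:R <= r%:R ^+ 2 :> R.
Proof. by rewrite expr2 ler_peMl //; move: r2; lra. Qed.
Let rt0 : 400 * r%:R ^+ 2 <= t0.
Proof.
have : dl * t0 <= 200^-1 * t0 by rewrite ler_wpM2r // ltW.
have : 0 <= r%:R ^+ 2 :> R by rewrite exprn_ge0.
by move: t0_large; lra.
Qed.
Let t0n : 1000 * t0 <= n%:R.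
Proof.
have : dl * n%:R <= 200^-1 * n%:R by rewrite ler_wpM2r.
by move: t0n_small t0_gt0; lra.
Qed.
Let K_le2 : K <= 2.
Proof.
have : r%:R * (K - 2) <= 0.
  by move: K_le r2; lra.
by rewrite pmulr_rle0 ?ltr0n //; lra.
Qed.

Lemma npX (t : R) : n%:R * ((t * p) ^+ r / r`!%:R) =
  (t / t0) ^+ r * ((1 + dl) * (t0 / r%:R)).
Proof.
have f0 : s`!%:R != 0 :> R by rewrite pnatr_eq0 -lt0n fact_gt0.
have r0 : r%:R != 0 :> R by rewrite pnatr_eq0.
have tn0 : t0 != 0 by rewrite gt_eqF.
have -> : 1 + dl = n%:R * p ^+ r * t0 ^+ s / s`!%:R by rewrite t0E mulfK.
rewrite exprMn expr_div_n factS natrM [t0 ^+ r]exprS.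
have tns : t0 ^+ s != 0 by rewrite expf_neq0.
move: (t ^+ r) (p ^+ r) (t0 ^+ s) (s`!%:R) (r%:R : R) tns f0 r0 => X Y Z F Q Z0 F0 Q0.
by field; rewrite Z0 F0 tn0 Q0.
Qed.

Lemma n_pi_upper (t : nat) : n%:R * pi t <= (t%:R / t0) ^+ r * ((1 + dl) * (t0 / r%:R)).
Proof. by rewrite -npX ler_wpM2l // pi_hat_upper. Qed.

Lemma n_pi_lower (t : nat) : t0 / 2 <= t%:R -> t%:R * p <= 200^-1 ->
  (99 / 100) * ((t%:R / t0) ^+ r * (t0 / r%:R)) <= n%:R * pi t.
Proof.
move=> tt tp.
have t_gt0 : 0 < t%:R :> R by move: t0_gt0; lra.
have rt : 200 * r%:R ^+ 2 <= t%:R :> R by move: rt0; lra.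
have rlt : (r <= t)%N by rewrite -(ler_nat R); move: rt rr r2; lra.
have tp1 : t%:R * p <= 1 by apply: le_trans tp _; rewrite invf_le1 ?ltr0n ?ler1n.
have low := binomial_pmf_lower p01 rlt tp1.
have x01 : 0 <= (r%:R / t%:R : R) <= 1.
  by rewrite divr_ge0 //= ler_pdivrMr // mul1r ler_nat.
have bern := bernoulli_ineq r x01.
have x2 : r%:R * (r%:R / t%:R) <= 200^-1 :> R.
  by rewrite mulrA -expr2 ler_pdivrMr // ; move: rt; lra.
have E : p * (t%:R - r%:R) = (t%:R * p) * (1 - r%:R / t%:R).
  by field; rewrite gt_eqF.
have low2 : (99 / 100) * ((t%:R * p) ^+ r / r`!%:R) <= pi t.
  apply: le_trans (pi_hat_ge_pmf p01 _ _); apply: le_trans low.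
  rewrite mulrA ler_wpM2r ?invr_ge0 // E [in leRHS]exprMn mulrCA.
  rewrite mulrC ler_wpM2l ?exprn_ge0 ?mulr_ge0 ?(ltW p_gt0) //.
  apply: (@le_trans _ _ ((1 - 200^-1) * (1 - 200^-1))); first by lra.
  by apply: ler_pM; lra.
move: low2 => /(ler_wpM2l (ltW n_gt0)); apply: le_trans.
rewrite [leRHS]mulrCA npX ler_wpM2l ?divr_ge0 //.
rewrite ler_wpM2l ?exprn_ge0 ?divr_ge0 ?(ltW t0_gt0) //.
by rewrite ler_peMl ?divr_ge0 ?(ltW t0_gt0) // lerDl ltW.
Qed.

Lemma pi_increment (t : nat) : t0 - 1 <= t%:R -> t%:R <= 2 * t0 ->
  1 <= (pi t.+1 - pi t) * (n%:R - t0).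
Proof.
move=> tt tle.
have dg := dl_gt0; have tg := t0_gt0; have pg := p_gt0; have d1 := dl1; have rg := r2.
have t_gt0 : 0 < t%:R :> R by move: rt0 rr r2; lra.
have slt : (s <= t)%N.
  have : r%:R <= t%:R :> R by move: rt0 rr r2; lra.
  by rewrite ler_nat => /ltnW.
have tp : t%:R * p <= dl / 6.
  have : t%:R * p <= 2 * t0 * p by rewrite ler_wpM2r // ltW.
  have : 2 * (t0 * p) <= r%:R * (t0 * p) by rewrite ler_wpM2r // mulr_ge0 ?ltW.
  by move: t0p_small; lra.
have low := binomial_pmf_lower p01 slt (le_trans tp (_ : dl / 6 <= 1)).
move: low => /(_ ltac:(move: dl1; lra)) low.
have x01 : 0 <= r%:R / t0 <= 1.
  by rewrite divr_ge0 ?(ltW t0_gt0) //= ler_pdivrMr // mul1r; move: rt0 rr r2; lra.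
have bern := bernoulli_ineq s x01.
have x2 : s%:R * (r%:R / t0) <= dl / 6 :> R.
  rewrite mulrA ler_pdivrMr //.
  have : s%:R * r%:R <= r%:R ^+ 2 :> R by rewrite expr2 ler_wpM2r // ler_nat.
  by move: t0_large; nra.
have x3 : t0 / n%:R <= dl / 6.
  by rewrite ler_pdivrMr //; move: t0n_small; nra.
rewrite pi_hatS // addrAC subrr add0r.
have ge : p * (t0 * (1 - r%:R / t0)) <= p * (t%:R - s%:R).
  rewrite ler_wpM2l ?(ltW p_gt0) // mulrBr mulr1 mulrCA divff ?gt_eqF // mulr1.
  by rewrite -natr1; lra.
have low2 : (1 - dl / 6) * (p ^+ s * t0 ^+ s * (1 - dl / 6)) / s`!%:R <= binomial_pmf t p s.
  apply: le_trans low; rewrite ler_wpM2r ?invr_ge0 //.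
  have d6 : 0 <= 1 - dl / 6 by move: dl1; lra.
  apply: ler_pM => //; first by rewrite mulr_ge0 // mulr_ge0 ?exprn_ge0 ?(ltW p_gt0) ?(ltW t0_gt0).
    by lra.
  apply: (@le_trans _ _ ((p * (t0 * (1 - r%:R / t0))) ^+ s)).
    by rewrite !exprMn mulrA ler_wpM2l ?mulr_ge0 ?exprn_ge0 ?(ltW p_gt0) ?(ltW t0_gt0) //; lra.
  rewrite lerXn2r // nnegrE ?mulr_ge0 ?(ltW p_gt0) ?(ltW t0_gt0) //; first by case/andP: x01; lra.
  by rewrite subr_ge0 ler_nat.
have nt : (1 - dl / 6) * n%:R <= n%:R - t0.
  by move: x3; rewrite ler_pdivrMr //; lra.
have f0 : s`!%:R != 0 :> R by rewrite pnatr_eq0 -lt0n fact_gt0.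
apply: (@le_trans _ _ (p * ((1 - dl / 6) * (p ^+ s * t0 ^+ s * (1 - dl / 6)) / s`!%:R) * ((1 - dl / 6) * n%:R))).
  have -> : p * ((1 - dl / 6) * (p ^+ s * t0 ^+ s * (1 - dl / 6)) / s`!%:R) * ((1 - dl / 6) * n%:R) =
     (n%:R * p ^+ r * t0 ^+ s) / s`!%:R * (1 - dl / 6) ^+ 3.
    by rewrite exprS; ring.
  rewrite t0E mulfK //.
  have : 1 - 3 * (dl / 6) <= (1 - dl / 6) ^+ 3.
    by apply: bernoulli_ineq; move: dl1 dl_gt0; lra.
  move=> /(ler_wpM2l (_ : 0 <= 1 + dl)) -/(_ ltac:(move: dl_gt0; lra)).
  apply: le_trans; move: dl_gt0 dl1; nra.
apply: ler_pM => //.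
- rewrite !mulr_ge0 ?invr_ge0 ?exprn_ge0 ?(ltW p_gt0) ?(ltW t0_gt0) //; move: dl1; lra.
- by rewrite mulr_ge0 //; move: dl1; lra.
- by rewrite ler_wpM2l ?(ltW p_gt0).
Qed.

Hypothesis ac_ge0 : 0 <= ac.
Hypothesis al_ge0 : 0 <= al.
Hypothesis al_le : al <= t0 - ac.
Hypothesis aE : a%:R = ac + al.
Hypothesis ac_min : forall t : nat, (t <= Num.truncn t0)%N ->
  t%:R <= n%:R - (1 - pi t) * (n%:R - ac).

Local Notation k := (Num.truncn (K * t0)).
Local Notation E2 := (s%:R * al ^+ 2 / (8 * (t0 + s%:R * al / 2))).

Let Kt0_ge0 : 0 <= K * t0.
Proof. by rewrite mulr_ge0 ?(ltW t0_gt0) //; move: K_gt1; lra. Qed.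

Let k_le : k%:R <= K * t0. Proof. by have /andP[] := truncn_itv Kt0_ge0. Qed.
Let k_gt : K * t0 < k.+1%:R. Proof. by have /andP[] := truncn_itv Kt0_ge0. Qed.
Let Kt0_le : K * t0 <= 2 * t0. Proof. by rewrite ler_wpM2r // ltW. Qed.
Let t0_Kt0 : t0 <= K * t0. Proof. by rewrite ler_peMl // ltW. Qed.

Lemma barrier_below (t : nat) : (t <= k)%N ->
  t%:R <= n%:R - (1 - pi t) * (n%:R - ac).
Proof.
have [tau|tau] := leqP t (Num.truncn t0); first by move=> _; exact: ac_min.
elim: t tau => [//|t IH]; rewrite ltnS leq_eqVlt => tau tk.
have Ht : t%:R <= n%:R - (1 - pi t) * (n%:R - ac).
  case/orP: tau => [/eqP <-|tau]; first exact: ac_min.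
  by apply: IH => //; exact: ltnW.
have tt : t0 - 1 <= t%:R.
  have /andP[_] := truncn_itv (ltW t0_gt0); rewrite -natr1 => lt.
  have : (Num.truncn t0)%:R <= t%:R :> R.
    by rewrite ler_nat; case/orP: tau => [/eqP ->|/ltnW].
  by lra.
have tle : t%:R <= 2 * t0.
  have : t%:R <= k%:R :> R by rewrite ler_nat ltnW.
  by move: k_le Kt0_le; lra.
have := pi_increment tt tle.
have : (pi t.+1 - pi t) * (n%:R - t0) <= (pi t.+1 - pi t) * (n%:R - ac).
  rewrite ler_wpM2l //; first by rewrite subr_ge0 pi_hat_nondecr.
  by move: al_le al_ge0; lra.
by rewrite -natr1; lra.
Qed.

Let t0r : 400 * r%:R <= t0. Proof. by move: rt0 rr; lra. Qed.
Let t0r1 : 400 <= t0 / r%:R.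
Proof. by rewrite ler_pdivlMr ?ltr0n. Qed.

Lemma ac_lower : t0 - 1 - (1 + dl) * (t0 / r%:R) <= ac.
Proof.
have /andP[tau1] := truncn_itv (ltW t0_gt0); rewrite -natr1 => tau2.
have := ac_min (leqnn (Num.truncn t0)); set tau := Num.truncn t0.
have le1 : (tau%:R / t0) ^+ r * ((1 + dl) * (t0 / r%:R)) <= (1 + dl) * (t0 / r%:R).
  rewrite ler_piMl ?mulr_ge0 ?divr_ge0 ?(ltW t0_gt0) //; first by move: dl_gt0; lra.
  by rewrite exprn_ile1 ?divr_ge0 ?(ltW t0_gt0) // ler_pdivrMr // mul1r.
have : 0 <= pi tau * ac by rewrite mulr_ge0 ?pi_hat_ge0.
have := le_trans (n_pi_upper tau) le1.
move: tau2; rewrite -/tau; move: (_ * (t0 / r%:R)) (pi tau) => Y q; lra.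
Qed.

Lemma al_upper : al <= (101 / 100) * (t0 / r%:R).
Proof.
have := ac_lower.
have : dl * (t0 / r%:R) <= 200^-1 * (t0 / r%:R).
  by rewrite ler_wpM2r ?divr_ge0 ?(ltW t0_gt0).
by move: t0r1 al_le; move: (t0 / r%:R) => T; lra.
Qed.

Let a_le : a%:R <= t0. Proof. by rewrite aE; move: al_le; lra. Qed.

Let V := 4 * (1 + dl) * (t0 / r%:R).

Lemma n_pik_upper : n%:R * pi k <= V.
Proof.
apply: le_trans (n_pi_upper k) _; rewrite /V -mulrA.
rewrite ler_wpM2r ?mulr_ge0 ?divr_ge0 ?(ltW t0_gt0) //; first by move: dl_gt0; lra.
rewrite -KE; apply: lerXn2r; rewrite ?nnegrE ?divr_ge0 ?(ltW t0_gt0) //.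
  by move: K_gt1; lra.
by rewrite ler_pdivrMr.
Qed.

Lemma pik_small : pi k <= (100 * r%:R)^-1.
Proof.
have r0 : 0 < r%:R :> R by rewrite ltr0n.
rewrite -(ler_pM2l n_gt0); apply: le_trans n_pik_upper _.
rewrite /V mulrA invfM mulrA ler_wpM2r ?invr_ge0 ?(ltW r0) //.
have : (1 + dl) * t0 <= 2 * t0 by rewrite ler_wpM2r ?(ltW t0_gt0) //; move: dl1; lra.
by move: t0n t0_gt0; lra.
Qed.

Lemma n_pik_lower : (39 / 10) * (t0 / r%:R) <= n%:R * pi k.
Proof.
have r0 : 0 < r%:R :> R by rewrite ltr0n.
have kt : t0 / 2 <= k%:R by move: k_gt t0_Kt0 t0r r2; rewrite -natr1; lra.
have kp : k%:R * p <= 200^-1.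
  have : k%:R * p <= 2 * t0 * p.
    by rewrite ler_wpM2r ?(ltW p_gt0) //; move: k_le Kt0_le; lra.
  have : 2 * (t0 * p) <= r%:R * (t0 * p).
    by rewrite ler_wpM2r ?mulr_ge0 ?(ltW p_gt0) ?(ltW t0_gt0).
  by move: t0p_small dl1; lra.
apply: le_trans (n_pi_lower kt kp); rewrite mulrA ler_wpM2r ?divr_ge0 ?(ltW t0_gt0) //.
have x01 : 0 <= t0^-1 <= 1.
  by rewrite invr_ge0 (ltW t0_gt0) /= invf_le1 //; move: t0r r2; lra.
have : 4 * (1 - t0^-1) ^+ r <= (k%:R / t0) ^+ r.
  rewrite -KE -exprMn; apply: lerXn2r; rewrite ?nnegrE.
  - by rewrite mulr_ge0 ?subr_ge0 //; case/andP: x01 => //; move: K_gt1; lra.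
  - by rewrite divr_ge0 ?(ltW t0_gt0).
  rewrite ler_pdivlMr // mulrBr mulr1 mulrBl divfK ?gt_eqF //.
  by move: k_gt K_gt1; rewrite -natr1; lra.
have := bernoulli_ineq r x01.
have : r%:R * t0^-1 <= 400^-1.
  rewrite ler_pdivrMr // mulrC ler_pdivlMr ?ltr0n //.
  by move: t0r; rewrite mulrC.
lra.
Qed.

Let na_ge : (999 / 1000) * n%:R <= n%:R - a%:R :> R.
Proof. by move: a_le t0n; lra. Qed.

Lemma barrier_middle (t : nat) : (k < t)%N -> t%:R * p <= 200^-1 ->
  t%:R <= a%:R + (1 - 21 / 100) * (n%:R - a%:R) * pi t.
Proof.
move=> kt tp.
have tK : K * t0 < t%:R by apply: lt_le_trans k_gt _; rewrite ler_nat.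
have tt : t0 / 2 <= t%:R by move: tK t0_Kt0 t0_gt0; lra.
set T := t0 / r%:R.
have T1 : 400 <= T by exact: t0r1.
have t0T : t0 = r%:R * T by rewrite /T mulrCA divff ?mulr1 ?pnatr_eq0.
have K0 : 0 < K by move: K_gt1; lra.
pose w := t%:R / (K * t0) - 1.
have w0 : 0 <= w by rewrite /w subr_ge0 ler_pdivlMr ?mulr_gt0 // mul1r ltW.
have tw : t%:R / t0 = K * (1 + w).
  by rewrite /w addrCA subrr addr0; field; rewrite !gt_eqF.
have X4 : 4 * (1 + r%:R * w) <= (t%:R / t0) ^+ r.
  by rewrite tw exprMn KE ler_wpM2l // bernoulli_ineq_pos.
have low := n_pi_lower tt tp; rewrite -/T in low.
have a1 : t0 - 1 - (1 + dl) * T <= a%:R by rewrite aE; have := ac_lower; move: al_ge0; rewrite -/T; lra.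
have tE : t%:R = T * (r%:R * K + r%:R * K * w).
  have -> : T * (r%:R * K + r%:R * K * w) = t0 * (K * (1 + w)) by rewrite t0T; ring.
  by rewrite -tw mulrCA divff ?mulr1 // gt_eqF.
have N1 : (99 / 100) * (999 / 1000) * (4 * (1 + r%:R * w) * T) <= (n%:R - a%:R) * pi t.
  apply: (@le_trans _ _ ((999 / 1000) * n%:R * pi t)); last first.
    by rewrite ler_wpM2r ?pi_hat_ge0.
  have : 4 * (1 + r%:R * w) * T <= (t%:R / t0) ^+ r * T.
    by rewrite ler_wpM2r //; move: T1; lra.
  by move: low; move: ((t%:R / t0) ^+ r * T) => XT; lra.
have T0 : 0 <= T by apply: le_trans T1; rewrite ler0n.
clearbody T.
have rK2 : r%:R * K * w <= 2 * (r%:R * w).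
  by rewrite mulrAC [leRHS]mulrC ler_wpM2l ?mulr_ge0.
have main : T * (r%:R * K + r%:R * K * w) <= T * (r%:R + 2 + 2 * (r%:R * w)).
  by rewrite ler_wpM2l // lerD.
have rw0 : 0 <= r%:R * w * T by rewrite !mulr_ge0.
have dT : dl * T <= 200^-1 * T by rewrite ler_wpM2r.
rewrite tE; apply: le_trans main _; rewrite -mulrA.
move: a1 N1 rw0; rewrite {1}t0T; move: (r%:R * w) => rw.
move: (r%:R : R) ((n%:R - a%:R) * pi t) => Q Y; nra.
Qed.

Lemma barrier_linear (t : nat) : 200^-1 < t%:R * p -> t%:R <= @linear_const R r * n%:R ->
  t%:R <= a%:R + (1 - 21 / 100) * (n%:R - a%:R) * pi t.
Proof.
move=> tp tc.
have q0 : 0 <= (200 * p)^-1 by rewrite invr_ge0 mulr_ge0 ?ler0n ?(ltW p_gt0).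
have /andP[t2l t2u] := truncn_itv q0; set t2 := Num.truncn _ in t2l t2u.
rewrite -[t2.+1%:R]natr1 in t2u.
have pE : (200 * p)^-1 * p = 200^-1 by field; rewrite gt_eqF.
have t2p : t2%:R * p <= 200^-1 by rewrite -pE ler_wpM2r ?(ltW p_gt0).
have t2p' : 200^-1 < t2%:R * p + p.
  have : (200 * p)^-1 * p < (t2%:R + 1) * p by rewrite ltr_pM2r.
  by rewrite pE mulrDl mul1r.
have pr : r%:R * p <= 1000^-1.
  have : r%:R * p <= r%:R * (t0 * p).
    by rewrite ler_wpM2l // ler_peMl ?(ltW p_gt0) //; move: t0r r2; lra.
  by move: t0p_small dl1; lra.
have p1 : 2 * p <= r%:R * p by rewrite ler_wpM2r ?(ltW p_gt0).
have t2t : (t2 <= t)%N.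
  rewrite -ltnS -(ltr_nat R) -natr1 -(ltr_pM2r p_gt0) mulrDl mul1r.
  by move: p_gt0; lra.
have c400 : 0 <= 400^-1 :> R by rewrite invr_ge0 ler0n.
have p400 : 400^-1 <= p * (t2%:R - r%:R) by rewrite mulrBr [p * r%:R]mulrC; lra.
have rt2 : (r <= t2)%N.
  rewrite -(ler_nat R) -subr_ge0 -(pmulr_rge0 _ p_gt0); exact: le_trans c400 p400.
have pi2 : 2 * @linear_const R r <= pi t2.
  apply: le_trans (pi_hat_ge_pmf p01 _ _).
  have t2p1 : t2%:R * p <= 1 by apply: le_trans t2p _; rewrite invf_le1 ?ltr0n ?ler1n.
  apply: le_trans (binomial_pmf_lower p01 rt2 t2p1).
  rewrite /linear_const.
  have : 400^-1 ^+ r <= (p * (t2%:R - r%:R)) ^+ r.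
    by apply: lerXn2r; rewrite ?nnegrE ?c400 ?(le_trans c400 p400).
  have : 0 <= (p * (t2%:R - r%:R)) ^+ r by rewrite exprn_ge0 // (le_trans c400 p400).
  have f0 : 0 <= r`!%:R^-1 :> R by rewrite invr_ge0.
  move: (400^-1 ^+ r) ((p * (t2%:R - r%:R)) ^+ r) => b X X0 bX.
  have h : b * r`!%:R^-1 <= X * r`!%:R^-1 by rewrite ler_wpM2r.
  have : 0 <= (2^-1 - t2%:R * p) * (X * r`!%:R^-1).
    by rewrite !mulr_ge0 // subr_ge0; lra.
  by move: h; rewrite -[(1 - _) * X * _]mulrA; move: (X * _) (b * _) => XX bb; lra.
have pit : 2 * @linear_const R r <= pi t by apply: le_trans pi2 _; exact: pi_hat_nondecr.
have c0 : 0 < @linear_const R r by case/andP: (linear_const_bounds R r).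
apply: le_trans tc _.
have na9 : 9 / 10 * n%:R <= n%:R - a%:R :> R by move: na_ge n_gt0; lra.
have n9 : 0 <= 9 / 10 * (n%:R : R) by rewrite mulr_ge0 // divr_ge0.
have c2 : 0 <= 2 * @linear_const R r by lra.
have := ler_pM n9 c2 na9 pit.
have : 0 <= @linear_const R r * n%:R by rewrite mulr_ge0 // ltW.
have : 0 <= a%:R :> R by [].
by rewrite -[_ * (n%:R - _) * _]mulrA; move: ((n%:R - a%:R) * _) => Y; lra.
Qed.

Lemma E2_le_t0r : E2 <= (17 / 200) * (t0 / r%:R).
Proof.
have au := al_upper; set T := t0 / r%:R in au *.
have T0 : 0 <= T by rewrite divr_ge0 ?(ltW t0_gt0).
have t0T : t0 = r%:R * T by rewrite /T mulrCA divff ?mulr1 ?pnatr_eq0.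
clearbody T.
have s1 : 0 <= s%:R :> R by [].
have sr : r%:R = s%:R + 1 :> R by rewrite natr1.
rewrite ler_pdivrMr; last by rewrite mulr_gt0 // ltr_wpDr // !mulr_ge0.
have sa : 0 <= s%:R * al by rewrite mulr_ge0.
have h1 : s%:R * al * al <= s%:R * al * ((101 / 100) * T) by rewrite ler_wpM2l.
have h2 : s%:R * al * T <= s%:R * ((101 / 100) * T) * T.
  by rewrite ler_wpM2r // ler_wpM2l.
have h3 : 0 <= s%:R * T * T by rewrite !mulr_ge0.
have h4 : 0 <= T * T by rewrite !mulr_ge0.
rewrite t0T sr expr2; lra.
Qed.

Hypothesis t0_lin : 2 * t0 <= @linear_const R r * n%:R.
Local Notation k2 := (Num.truncn (@linear_const R r * n%:R)).
Local Notation eps := (2 * Num.sqrt (t0 / n%:R) + t0 / n%:R + (1 - pi k2)).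
Hypothesis eps_small : eps <= 2^-1.

Lemma percolation_prob_ge :
  1 - 3 * expR (- E2) <=
  bootstrap_prob p a (fun (E : {set {set 'I_n}}) (A : {set 'I_n}) =>
    `| #|bootstrap_final r E A|%:R - n%:R | <= eps * n%:R).
Proof.
have t0g := t0_gt0; have ng := n_gt0; have tn := t0n; have ale := a_le.
have an : (a <= n)%N by rewrite -(ler_nat R); move: ale tn t0g; lra.
have x0 : 0 < t0 / n%:R by rewrite divr_gt0.
have xE : t0 / n%:R * n%:R = t0 by rewrite divfK // gt_eqF.
have sq0 : 0 <= Num.sqrt (t0 / n%:R) by exact: sqrtr_ge0.
have sqE : Num.sqrt (t0 / n%:R) ^+ 2 = t0 / n%:R by rewrite sqr_sqrtr // ltW.
have q2le : pi k2 <= 1 by exact: pi_hat_le1.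
have es := eps_small; move: es x0 xE sq0 sqE.
set x := t0 / n%:R; set sq := Num.sqrt x => es x0 xE sq0 sqE.
set e := 2 * sq + x + (1 - pi k2) in es *.
have e0 : 0 < e by rewrite /e; lra.
have en0 : 0 <= (1 - e) * n%:R by rewrite mulr_ge0 //; lra.
have /andP[ml mu] := truncn_itv en0.
pose m := (Num.truncn ((1 - e) * n%:R)).+1.
have mn : (m <= n)%N.
  rewrite /m -(ltr_nat R); apply: le_lt_trans ml _.
  by rewrite gtr_pMl //; lra.
have /andP[c0 c1] := linear_const_bounds R r.
have cn0 : 0 <= @linear_const R r * n%:R by rewrite mulr_ge0 // ltW.
have /andP[k2l k2u] := truncn_itv cn0.
have kk2 : (k <= k2)%N.
  by rewrite truncn_ge_nat //; move: k_le Kt0_le t0_lin; lra.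
have k2m : (k2 <= m)%N.
  rewrite /m; apply: leqW; rewrite truncn_ge_nat //; apply: le_trans k2l _.
  by rewrite ler_wpM2r //; lra.
set T := t0 / r%:R.
have T1 : 400 <= T by exact: t0r1.
have T0 : 0 < T by rewrite divr_gt0 // ltr0n.
have t0T : t0 = r%:R * T by rewrite /T mulrCA divff ?mulr1 ?pnatr_eq0.
have dg := dl_gt0; have alg := al_ge0.
have nkl := n_pik_lower; rewrite -/T in nkl.
have pk0 : 0 < pi k.
  by rewrite -(pmulr_rgt0 _ ng); apply: lt_le_trans nkl; lra.
have rp0 : 0 < r%:R :> R by rewrite ltr0n.
have pks : r%:R * pi k <= 100^-1.
  have := ler_wpM2l (ltW rp0) pik_small.
  by rewrite invfM mulrCA divff ?mulr1 // gt_eqF.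
have pk2r : 2 * pi k <= r%:R * pi k by rewrite ler_wpM2r ?(ltW pk0) // r2.
have pk1 : pi k < 1 by lra.
have V0 : 0 < V by rewrite /V !mulr_gt0 //; lra.
pose lam := (1 - pi k) * al / V.
have lam0 : 0 <= lam by rewrite !mulr_ge0 ?invr_ge0 ?(ltW V0) //; lra.
apply: bootstrap_prob_ge => // A Aa.
have NE : #|~: A|%:R = n%:R - a%:R :> R.
  rewrite -natrB //; congr _%:R; have := cardsC A; rewrite card_ord Aa.
  by move=> h; apply/eqP; rewrite -(eqn_add2l a) h subnKC.
apply: (@le_trans _ _ (bern_exp (complete_edges n) p
    (fun E => (#|bootstrap_final r E A| < m)%N%:R))).
  apply: bern_exp_le => // E _; rewrite ler_nat.
  case: (boolP (_ <= e * n%:R)) => //=; rewrite -ltNge => h; rewrite lt0b.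
  have Fn : #|bootstrap_final r E A|%:R <= n%:R :> R.
    by rewrite ler_nat -[leqRHS](card_ord n) max_card.
  move: h; rewrite ler0_norm ?subr_le0 // => h.
  by rewrite /m ltnS truncn_ge_nat //; lra.
have H1 (t : nat) : (t <= k)%N -> t%:R <= n%:R - (1 - pi t) * (#|~: A|%:R + al).
  move=> /barrier_below; rewrite NE aE.
  by have -> : n%:R - (ac + al) + al = n%:R - ac by ring.
have H2 (t : nat) : (k < t <= k2)%N ->
    t%:R <= #|A|%:R + (1 - 21 / 100) * #|~: A|%:R * pi t.
  move=> /andP[kt tk2]; rewrite NE Aa.
  have [tp|tp] := leP (t%:R * p) 200^-1; first exact: barrier_middle.
  by apply: barrier_linear => //; apply: le_trans k2l; rewrite ler_nat.
have nx : (1 - x) * n%:R <= n%:R - a%:R by rewrite mulrBl mul1r xE; lra.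
have q2g : 0 <= pi k2 by exact: pi_hat_ge0.
have H3 (t : nat) : (k2 < t < m)%N ->
    t%:R <= #|A|%:R + (1 - 2 * sq) * #|~: A|%:R * pi t.
  move=> /andP[kt tm]; rewrite NE Aa.
  have tle : t%:R <= (1 - e) * n%:R by apply: le_trans ml; rewrite ler_nat -ltnS.
  have pit : pi k2 <= pi t by rewrite pi_hat_nondecr // ltnW.
  apply: le_trans tle _; rewrite -[leLHS]add0r lerD //.
  apply: (@le_trans _ _ ((1 - 2 * sq) * ((1 - x) * n%:R) * pi k2)); last first.
    have es' := es; rewrite /e in es'.
    rewrite -[leLHS]mulrA -[leRHS]mulrA ler_wpM2l //; first by lra.
    by apply: ler_pM => //; rewrite mulr_ge0 //; lra.
  have -> : (1 - 2 * sq) * ((1 - x) * n%:R) * pi k2 = (1 - 2 * sq) * (1 - x) * pi k2 * n%:R by ring.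
  rewrite ler_wpM2r //.
  have h1 : 1 - 2 * sq - x <= (1 - 2 * sq) * (1 - x).
    have : 0 <= sq * x by rewrite mulr_ge0 // ltW.
    lra.
  have : (1 - 2 * sq - x) * pi k2 <= (1 - 2 * sq) * (1 - x) * pi k2 by rewrite ler_wpM2r.
  have : 0 <= (2 * sq + x) * (1 - pi k2) by rewrite mulr_ge0 ?subr_ge0 //; lra.
  by rewrite /e; lra.
have eta0 : 0 <= 2 * sq by rewrite mulr_ge0.
have e21 : 0 <= 21 / 100 :> R by rewrite divr_ge0.
apply: le_trans (bootstrap_fail_bound p01 kk2 k2m mn lam0 e21 eta0 pk0 pk1 H1 H2 H3) _.
rewrite NE.
have E2a : E2 <= s%:R * al ^+ 2 / (8 * t0).
  rewrite ler_wpM2l ?mulr_ge0 ?exprn_ge0 // lef_pV2 ?posrE ?mulr_gt0 //.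
    by rewrite ler_wpM2l // lerDl !mulr_ge0.
  by rewrite ltr_wpDr // !mulr_ge0.
have sr : s%:R = r%:R - 1 :> R by rewrite -[r%:R]natr1 addrK.
have sd : s%:R * (1 + dl) <= (1 - pi k) ^+ 2 * r%:R.
  have : 0 <= pi k ^+ 2 * r%:R by rewrite mulr_ge0 ?exprn_ge0 ?(ltW pk0).
  by move: dl_small pks; rewrite sr; move: (r%:R : R) (pi k) => Q q; lra.
have B1 : (n%:R - a%:R) * pi k * lam ^+ 2 / 2 - lam * (1 - pi k) * al <= - E2.
  have h : (n%:R - a%:R) * pi k * lam ^+ 2 / 2 <= V * lam ^+ 2 / 2.
    rewrite !ler_wpM2r ?invr_ge0 ?exprn_ge0 //.
    apply: le_trans n_pik_upper; rewrite ler_wpM2r ?(ltW pk0) //.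
    by rewrite lerBlDr lerDl.
  have E : V * lam ^+ 2 / 2 - lam * (1 - pi k) * al = - ((1 - pi k) ^+ 2 * al ^+ 2 / (2 * V)).
    by rewrite /lam; field; rewrite gt_eqF.
  have E2b : E2 <= (1 - pi k) ^+ 2 * al ^+ 2 / (2 * V).
    apply: le_trans E2a _.
    have V2 : 0 < 2 * V by rewrite mulr_gt0.
    have t8 : 0 < 8 * t0 by rewrite mulr_gt0.
    rewrite (ler_pdivlMr _ _ V2) [leLHS]mulrAC (ler_pdivrMr _ _ t8).
    have : 0 <= al ^+ 2 * T by rewrite mulr_ge0 ?exprn_ge0 ?(ltW T0).
    move=> /ler_wpM2l/(_ _ _ sd).
    have -> : 8 * t0 = 8 * (r%:R * T) by rewrite -t0T.
    rewrite /V -/T; move: (al ^+ 2) ((1 - pi k) ^+ 2) (r%:R : R) => a2 q2 Q.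
    by lra.
  by lra.
have B2 : E2 <= (n%:R - a%:R) * pi k * (21 / 100) ^+ 2 / 2.
  have E2T := E2_le_t0r; rewrite -/T in E2T; apply: le_trans E2T _.
  have : (999 / 1000) * (n%:R * pi k) <= (n%:R - a%:R) * pi k.
    by rewrite mulrA ler_wpM2r ?(ltW pk0) // na_ge.
  move: nkl; move: (n%:R * pi k) ((n%:R - a%:R) * pi k) => u v; lra.
have B3 : E2 <= (n%:R - a%:R) * pi k2 * (2 * sq) ^+ 2 / 2.
  have E2T := E2_le_t0r; rewrite -/T in E2T; apply: (@le_trans _ _ t0).
    apply: le_trans E2T _; rewrite t0T.
    have : 2 * T <= r%:R * T by rewrite ler_wpM2r ?r2 ?(ltW T0).
    by move: T0; lra.
  rewrite exprMn sqE.
  have h : n%:R / 2 <= (n%:R - a%:R) * pi k2.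
    apply: (@le_trans _ _ ((1 - x) * n%:R * pi k2)); last by rewrite ler_wpM2r.
    have : 2^-1 <= (1 - x) * pi k2.
      have hq : 2^-1 + x <= pi k2 by move: es; rewrite /e; lra.
      have hx : x <= 2^-1 by move: es; rewrite /e; lra.
      have hx1 : 0 <= 1 - x by move: hx; lra.
      have hx2 : 0 <= x * (2^-1 - x) by rewrite mulr_ge0 ?subr_ge0 // ltW.
      by move: (ler_wpM2l hx1 hq) hx2; lra.
    move=> /(ler_wpM2r (ltW ng)); lra.
  have := ler_wpM2r (ltW x0) h; rewrite [n%:R / 2 * x]mulrC mulrA [x * n%:R]xE.
  by move: ((n%:R - a%:R) * pi k2) => v; lra.
have -> : 3 * expR (- E2) = expR (- E2) + expR (- E2) + expR (- E2) by ring.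
by rewrite lerD ?lerD ?ler_expR ?lerN2.
Qed.

End Deterministic.

(** * Orders of magnitude *)

Lemma powR_root (R : realType) (x : R) (m : nat) : 0 <= x -> (0 < m)%N ->
  (x `^ m%:R^-1) ^+ m = x.
Proof.
move=> x0 m0; rewrite -powR_mulrn ?powR_ge0 // -powRrM mulVf ?powRr1 //.
by rewrite pnatr_eq0 -lt0n.
Qed.

Lemma ler_root (R : realType) (m : nat) (x y : R) : (0 < m)%N -> 0 <= x -> 0 <= y ->
  x ^+ m <= y ^+ m -> x <= y.
Proof. by move=> m0 x0 y0; rewrite ler_pXn2r. Qed.

Lemma binomial_ineq2 (R : realType) (z : R) m : 0 <= z ->
  1 + m%:R * z + m%:R * (m%:R - 1) / 2 * z ^+ 2 <= (1 + z) ^+ m.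
Proof.
move=> z0; elim: m => [|m IH]; first by rewrite expr0 !mul0r !addr0.
have z1 : 0 <= 1 + z by lra.
rewrite [leRHS]exprS; apply: le_trans (ler_wpM2l z1 IH).
have : 0 <= m%:R * (m%:R - 1) / 2 * z ^+ 2 * z.
  rewrite mulr_ge0 // mulr_ge0 ?exprn_ge0 // divr_ge0 //.
  by case: m {IH} => [|m]; rewrite ?mul0r // mulr_ge0 // subr_ge0 ler1n.
rewrite -[m.+1%:R]natr1; lra.
Qed.

Lemma root4_bounds (R : realType) (r : nat) : (2 <= r)%N ->
  exists K : R, [/\ 1 < K, K ^+ r = 4 & r%:R * K <= r%:R + 2].
Proof.
move=> r2; have r0 : (0 < r)%N by exact: ltnW.
have rR : 2 <= r%:R :> R by rewrite (ler_nat _ 2).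
exists (4 `^ r%:R^-1); have KE : ((4 : R) `^ r%:R^-1) ^+ r = 4 by rewrite powR_root.
split=> //.
  rewrite ltNge; apply/negP => h.
  by have := exprn_ile1 r (powR_ge0 _ _) h; rewrite KE; lra.
have K1 : (4 : R) `^ r%:R^-1 <= 1 + 2 / r%:R.
  apply: (ler_root r0 (powR_ge0 _ _)).
    by rewrite addr_ge0 // divr_ge0.
  rewrite KE; apply: le_trans (binomial_ineq2 r _); last by rewrite divr_ge0.
  have -> : r%:R * (2 / r%:R) = 2 :> R by field; rewrite gt_eqF //; lra.
  have -> : r%:R * (r%:R - 1) / 2 * (2 / r%:R) ^+ 2 = 2 - 2 / r%:R :> R.
    by field; rewrite gt_eqF //; lra.
  have : 2 / r%:R <= 1 :> R by rewrite ler_pdivrMr ?mul1r //; lra.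
  by lra.
have := ler_wpM2l (ler0n _ r) K1; rewrite mulrDr mulr1.
by have -> : r%:R * (2 / r%:R) = 2 :> R by field; rewrite gt_eqF //; lra.
Qed.

Section Scales.
Context {R : realType} (s n : nat) (p : R).
Local Notation r := s.+1.
Local Notation dl := (delta r n p).
Local Notation t := (t0 r n p).
Hypothesis s0 : (0 < s)%N.
Hypothesis p_gt0 : 0 < p.
Hypothesis np1 : 1 <= n%:R * p.

Let n_gt0 : 0 < n%:R :> R.
Proof. by rewrite -(pmulr_lgt0 _ p_gt0); apply: lt_le_trans np1. Qed.

Let u := (n%:R * p ^+ r) `^ (2 * s)%:R^-1.
Let v := ((n%:R * p)^-1) `^ (4 * s)%:R^-1.

Let x_gt0 : 0 < n%:R * p ^+ r. Proof. by rewrite mulr_gt0 // exprn_gt0. Qed.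
Let y_gt0 : 0 < n%:R * p. Proof. by rewrite mulr_gt0. Qed.

Let uE : u ^+ (2 * s) = n%:R * p ^+ r.
Proof. by rewrite powR_root ?muln_gt0 //; exact: ltW. Qed.

Let vE : v ^+ (4 * s) = (n%:R * p)^-1.
Proof. by rewrite powR_root ?muln_gt0 // invr_ge0; exact: ltW. Qed.

Lemma deltaE : dl = Num.max u v.
Proof.
rewrite /delta /u /v -[r%:R]natr1 addrK !natrM; congr (Num.max _ _).
by rewrite -(powR_inv1 (ltW y_gt0)) -powRrM mulN1r.
Qed.

Let u_gt0 : 0 < u. Proof. exact: powR_gt0. Qed.
Let v_gt0 : 0 < v. Proof. by apply: powR_gt0; rewrite invr_gt0. Qed.
Let u_le : u <= dl. Proof. by rewrite deltaE le_max lexx. Qed.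
Let v_le : v <= dl. Proof. by rewrite deltaE le_max lexx orbT. Qed.

Lemma delta_gt0 : 0 < dl. Proof. exact: lt_le_trans u_le. Qed.

Lemma delta_le (eta : R) : 0 < eta -> n%:R * p ^+ r <= eta ^+ (2 * s) ->
  (n%:R * p)^-1 <= eta ^+ (4 * s) -> dl <= eta.
Proof.
move=> e0 h1 h2; rewrite deltaE ge_max; apply/andP; split.
  by apply: (@ler_root _ (2 * s)); rewrite ?muln_gt0 ?uE // ltW.
by apply: (@ler_root _ (4 * s)); rewrite ?muln_gt0 ?vE // ltW.
Qed.

Lemma t0X : t ^+ s = (1 + dl) * (s`!%:R / (n%:R * p ^+ r)).
Proof.
rewrite /t0 -[r%:R]natr1 addrK powR_root // mulr_ge0 ?divr_ge0 ?(ltW x_gt0) //.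
by rewrite addr_ge0 // (ltW delta_gt0).
Qed.

Lemma t0_gt0 : 0 < t.
Proof.
apply: powR_gt0; rewrite mulr_gt0 ?divr_gt0 ?ltr0n ?fact_gt0 //.
by rewrite addr_gt0 // delta_gt0.
Qed.

Lemma t0_eq : n%:R * p ^+ r * t ^+ s = (1 + dl) * s`!%:R.
Proof. by rewrite t0X mulrCA [X in _ * X]mulrC divfK // gt_eqF. Qed.

Let f1 : 1 <= s`!%:R :> R. Proof. by rewrite ler1n fact_gt0. Qed.

Lemma delta_t0 : dl^-1 <= dl * t.
Proof.
have d0 := delta_gt0; have t00 := t0_gt0.
apply: (@le_trans _ _ u^-1); first by rewrite lef_pV2 ?posrE.
apply: (@ler_root _ s) => //; first by rewrite invr_ge0 ltW.
  by rewrite mulr_ge0 ?ltW.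
rewrite exprMn t0X -uE.
apply: (@le_trans _ _ (u ^+ s * (u ^+ (2 * s))^-1)).
  by rewrite mul2n -addnn exprD invfM mulrA divff ?mul1r ?exprVn // expf_neq0 ?gt_eqF.
apply: ler_pM; rewrite ?invr_ge0 ?exprn_ge0 ?(ltW u_gt0) //.
  by apply: lerXn2r; rewrite ?nnegrE ?(ltW u_gt0) ?(ltW d0).
rewrite mulrA ler_peMl ?invr_ge0 ?exprn_ge0 ?(ltW u_gt0) //.
by have := f1; nra.
Qed.

Hypothesis dl_le1 : dl <= 1.

Lemma t0p_le : t * p <= 2 * s`!%:R * dl ^+ 4.
Proof.
have d0 := delta_gt0; have t00 := t0_gt0.
have c1 : 1 <= 2 * s`!%:R :> R by have := f1; lra.
apply: (@le_trans _ _ (2 * s`!%:R * v ^+ 4)); last first.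
  rewrite ler_wpM2l ?(le_trans _ c1) //.
  by apply: lerXn2r; rewrite ?nnegrE ?(ltW v_gt0) ?(ltW d0).
apply: (@ler_root _ s) => //; first by rewrite mulr_ge0 ?ltW.
  by rewrite mulr_ge0 ?exprn_ge0 ?(ltW v_gt0) ?(le_trans _ c1).
rewrite [leLHS]exprMn [leRHS]exprMn t0X -[(v ^+ 4) ^+ s]exprM vE.
have -> : (1 + dl) * (s`!%:R / (n%:R * p ^+ r)) * p ^+ s =
    (1 + dl) * s`!%:R * (n%:R * p)^-1.
  rewrite exprSr; field.
  by rewrite !gt_eqF ?exprn_gt0.
rewrite ler_wpM2r ?invr_ge0 ?(ltW y_gt0) //.
apply: (@le_trans _ _ (2 * s`!%:R)).
  by rewrite ler_wpM2r //; move: dl_le1; lra.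
by rewrite -[leLHS]expr1 ler_weXn2l.
Qed.

Lemma t0_le_n : t <= t * p * n%:R.
Proof.
by rewrite -mulrA [p * _]mulrC ler_peMr // ltW // t0_gt0.
Qed.

Hypothesis dl_small : 200 * r%:R ^+ 2 * s`!%:R * dl <= 1.

Let r1 : 1 <= r%:R :> R. Proof. by rewrite ler1n. Qed.
Let rr : r%:R <= r%:R ^+ 2 :> R.
Proof. by rewrite expr2 ler_peMl. Qed.

Lemma delta_small : 200 * r%:R ^+ 2 * dl <= 1.
Proof.
apply: le_trans dl_small; rewrite ler_wpM2r ?(ltW delta_gt0) //.
by rewrite ler_peMr // mulr_ge0 ?ler0n ?exprn_ge0.
Qed.

Lemma t0p_le_delta : 100 * r%:R * (t * p) <= dl.
Proof.
have d0 := delta_gt0.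
have r0 : 0 <= 100 * r%:R :> R by rewrite mulr_ge0 ?ler0n.
apply: le_trans (ler_wpM2l r0 t0p_le) _.
have d4 : dl ^+ 4 <= dl ^+ 2 by rewrite ler_wiXn2l // ltW.
apply: (@le_trans _ _ (100 * r%:R * (2 * s`!%:R * dl ^+ 2))).
  by rewrite ler_wpM2l // ler_wpM2l // mulr_ge0.
have -> : 100 * r%:R * (2 * s`!%:R * dl ^+ 2) = (200 * r%:R * s`!%:R * dl) * dl by ring.
rewrite ler_piMl ?(ltW d0) //; apply: le_trans dl_small.
rewrite ler_wpM2r ?(ltW d0) // ler_wpM2r // ler_wpM2l ?ler0n //.
Qed.

Lemma t0_regime : [/\ 100 * r%:R * dl <= 1, 100 * r%:R ^+ 2 <= dl * t,
  100 * r%:R * (t * p) <= dl, 100 * t <= dl * n%:R & t <= dl * n%:R].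
Proof.
have d0 := delta_gt0; have ds := delta_small; have tp := t0p_le_delta.
have t00 := t0_gt0; have tn := t0_le_n; have rl := rr; have rl1 := r1.
have tnd : 100 * t <= dl * n%:R.
  have : 100 * t <= 100 * r%:R * (t * p) * n%:R.
    have : t * p * n%:R <= r%:R * (t * p * n%:R).
      by rewrite ler_peMl // !mulr_ge0 ?ltW.
    have -> : 100 * r%:R * (t * p) * n%:R = 100 * (r%:R * (t * p * n%:R)) by ring.
    by move: tn; move: (t * p * n%:R) (r%:R : R) => z Q; lra.
  by move=> h; apply: le_trans h _; rewrite ler_wpM2r ?(ltW n_gt0).
have rd : r%:R * dl <= r%:R ^+ 2 * dl by rewrite ler_wpM2r ?(ltW d0).
have rd0 : 0 <= r%:R * dl by rewrite mulr_ge0 // ltW.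
split=> //.
- by move: ds; lra.
- apply: le_trans delta_t0; rewrite -[leRHS]div1r ler_pdivlMr //.
  by move: ds rd rd0; lra.
- by move: tnd t00; lra.
Qed.
End Scales.

Lemma a_c_min (R : realType) (r n : nat) (p : R) (t : nat) :
  (t <= Num.truncn (t0 r n p))%N -> - a_c r n p <= drift r n p t.
Proof.
move=> tt; rewrite /a_c opprK -ltnS in tt *.
by rewrite (bigD1 (Ordinal tt)) //= ge_min lexx.
Qed.

Lemma a_c_ge0 (R : realType) (s n : nat) (p : R) : 0 <= p <= 1 ->
  0 <= a_c s.+1 n p.
Proof.
move=> p01; have := @a_c_min R s.+1 n p 0 (leq0n _).
by rewrite /drift pi_hat0 // mulr0 subr0 mul0r oppr_le0.
Qed.

Lemma a_c_barrier (R : realType) (s n : nat) (p : R) (t : nat) : 0 <= p <= 1 ->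
  pi_hat s.+1 p t < 1 -> (t <= Num.truncn (t0 s.+1 n p))%N ->
  t%:R <= n%:R - (1 - pi_hat s.+1 p t) * (n%:R - a_c s.+1 n p).
Proof.
move=> p01 pt /a_c_min; rewrite /drift ler_pdivlMr ?subr_gt0 //; lra.
Qed.

Section Asymptotics.
Local Open Scope classical_set_scope.
Context {R : realType} (s : nat) (p : nat -> R).
Local Notation r := s.+1.
Hypothesis s0 : (0 < s)%N.
Hypothesis hp : forall n, 0 <= p n <= 1.
Hypothesis hp_omega : is_littleomega p (fun n => n%:R^-1).
Hypothesis hp_o : p =o_\oo (fun n => n%:R `^ (- r%:R^-1)).

Lemma np_large (M : R) : 0 < M ->
  \forall n \near \oo, 0 < p n /\ M <= n%:R * p n.
Proof.
move=> M0; have := hp_omega M0; apply: filterS2 (nbhs_infty_gt 0) => n n0.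
have nR : 0 < n%:R :> R by rewrite ltr0n.
rewrite ger0_norm ?invr_ge0 // ler_pdivrMr // mulrC => h; split=> //.
by rewrite -(pmulr_rgt0 _ nR); apply: lt_le_trans h.
Qed.

Lemma npr_small (eta : R) : 0 < eta -> \forall n \near \oo, n%:R * p n ^+ r <= eta.
Proof.
move=> e0; pose e := Num.min 1 eta.
have e1 : 0 < e by rewrite lt_min ltr01.
move/eqoP: hp_o => /(_ e e1); apply: filterS2 (nbhs_infty_gt 0) => n n0.
have nR : 0 < n%:R :> R by rewrite ltr0n.
have p0 : 0 <= p n by case/andP: (hp n).
rewrite ger0_norm // ger0_norm ?powR_ge0 // => h.
have : p n ^+ r <= (e * n%:R `^ (- r%:R^-1)) ^+ r.
  by apply: lerXn2r; rewrite ?nnegrE // mulr_ge0 ?powR_ge0 // ltW.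
rewrite exprMn powRN exprVn powR_root ?(ltW nR) // ler_pdivlMr // mulrC => h2.
apply: le_trans h2 _; apply: (@le_trans _ _ e); last by rewrite ge_min lexx orbT.
by rewrite exprS ler_piMr ?(ltW e1) // exprn_ile1 ?(ltW e1) // ge_min lexx.
Qed.

Lemma delta_near (eta : R) : 0 < eta ->
  \forall n \near \oo, [/\ 0 < p n, 1 <= n%:R * p n & delta r n (p n) <= eta].
Proof.
move=> e0.
have M0 : 0 < Num.max 1 (eta ^+ (4 * s))^-1 by rewrite lt_max ltr01.
apply: filterS2 (np_large M0) (npr_small (exprn_gt0 (2 * s) e0)) => n [p0 yM] x.
have y1 : 1 <= n%:R * p n by apply: le_trans yM; rewrite le_max lexx.
split=> //; apply: delta_le => //.
rewrite -[leRHS]invrK lef_pV2 ?posrE ?invr_gt0 ?exprn_gt0 //.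
  by apply: le_trans yM; rewrite le_max lexx orbT.
exact: lt_le_trans y1.
Qed.

Definition err (n : nat) : R :=
  2 * Num.sqrt (t0 r n (p n) / n%:R) + t0 r n (p n) / n%:R +
  (1 - pi_hat r (p n) (Num.truncn (@linear_const R r * n%:R))).

Lemma regime_small : exists2 eta : R, 0 < eta <= 1 &
  forall d : R, 0 <= d <= eta -> 200 * r%:R ^+ 2 * s`!%:R * d <= 1.
Proof.
have C0 : 1 <= 200 * r%:R ^+ 2 * s`!%:R :> R.
  by rewrite -natrX -!natrM ler1n !muln_gt0 fact_gt0.
move: (200 * _ * _ : R) C0 => C C0; have Cp : 0 < C by apply: lt_le_trans C0.
exists C^-1; first by rewrite invr_gt0 Cp invf_le1.
by move=> d /andP[_ /(ler_wpM2l (ltW Cp))]; rewrite divff ?gt_eqF.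
Qed.

Lemma t0n_near (eta : R) : 0 < eta ->
  \forall n \near \oo, t0 r n (p n) / n%:R <= eta.
Proof.
move=> e0; have [d /andP[d0 d1] Hd] := regime_small.
have m0 : 0 < Num.min d eta by rewrite lt_min d0.
apply: filterS2 (delta_near m0) (nbhs_infty_gt 0) => n [p0 y1 dle] n0.
move: dle; rewrite le_min => /andP[dle de].
have dg := delta_gt0 s p0 y1.
have [] := t0_regime s0 p0 y1 (le_trans dle d1) (Hd _ _).
  by rewrite (ltW dg).
move=> _ _ _ _ h; rewrite ler_pdivrMr ?ltr0n //; apply: le_trans h _.
by rewrite ler_wpM2r.
Qed.

Lemma pi_hat_near (eta : R) : 0 < eta ->
  \forall n \near \oo,
    1 - pi_hat r (p n) (Num.truncn (@linear_const R r * n%:R)) <= eta.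
Proof.
move=> e0; have /andP[c0 _] := linear_const_bounds R r.
pose L := 2 ^+ r / eta.
have L0 : 0 < L by rewrite divr_gt0 // exprn_gt0.
have M0 : 0 < (2 * L + 1) / @linear_const R r by rewrite divr_gt0 //; lra.
apply: filterS (np_large M0) => n [p0 yM].
apply: le_trans (pi_hat_compl_upper (hp n) _ _) _.
have cn : 0 <= @linear_const R r * n%:R by rewrite mulr_ge0 // ltW.
have /andP[_] := truncn_itv cn; set k := Num.truncn _; rewrite -natr1 => ku.
have kp : 2 * L <= k%:R * p n.
  have : @linear_const R r * n%:R * p n <= (k%:R + 1) * p n.
    by rewrite ler_wpM2r ?ltW.
  have : 2 * L + 1 <= @linear_const R r * n%:R * p n.
    move: yM; rewrite ler_pdivrMr // => h; apply: le_trans h _.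
    by rewrite [leLHS]mulrC mulrA.
  have : p n <= 1 by case/andP: (hp n).
  lra.
have hL : L <= expR (k%:R * p n / 2).
  by apply: le_trans (expR_ge1Dx _); lra.
rewrite expRN ler_pdivrMr ?expR_gt0 //.
by move: hL; rewrite /L ler_pdivrMr // => hL; apply: le_trans hL _; rewrite mulrC.
Qed.

Lemma err_ge0 n : 0 <= err n.
Proof.
have t00 : 0 <= t0 r n (p n) by exact: powR_ge0.
apply: addr_ge0; last by rewrite subr_ge0 pi_hat_le1.
by rewrite addr_ge0 ?mulr_ge0 ?sqrtr_ge0 ?invr_ge0.
Qed.

Lemma err_near (eta : R) : 0 < eta -> \forall n \near \oo, err n <= eta.
Proof.
move=> e0.
have e3 : 0 < Num.min (eta / 3) ((eta / 6) ^+ 2).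
  by rewrite lt_min divr_gt0 //= exprn_gt0 // divr_gt0.
have e3' : 0 < eta / 3 by rewrite divr_gt0.
apply: filterS2 (t0n_near e3) (pi_hat_near e3') => n.
rewrite le_min => /andP[h1 h2] h3.
have : Num.sqrt (t0 r n (p n) / n%:R) <= eta / 6.
  rewrite -[leRHS](@ger0_norm _ (eta / 6)) ?divr_ge0 ?(ltW e0) //.
  by rewrite -sqrtr_sqr; apply: ler_wsqrtr.
by move: h1 h3; rewrite /err; lra.
Qed.

Lemma err_cvg : err @ \oo --> 0.
Proof.
apply/cvgr0Pnorm_le => e e0; apply: filterS (err_near e0) => n.
by rewrite ger0_norm // err_ge0.
Qed.

Context (alpha : nat -> R) (a : nat -> nat).
Hypothesis halpha_omega : is_littleomega alpha (fun n => Num.sqrt (a_c r n (p n))).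
Hypothesis halpha_le : \forall n \near \oo, alpha n <= t0 r n (p n) - a_c r n (p n).
Hypothesis ha : \forall n \near \oo, (a n)%:R = a_c r n (p n) + alpha n.

Definition rate (n : nat) : R :=
  s%:R * alpha n ^+ 2 / (8 * (t0 r n (p n) + s%:R * alpha n / 2)).

Lemma regime_near : \forall n \near \oo,
  let dl := delta r n (p n) in let t := t0 r n (p n) in
  [/\ [/\ 0 < p n, 0 < t, 0 < dl, n%:R * p n ^+ r * t ^+ s = (1 + dl) * s`!%:R &
        2 * t <= @linear_const R r * n%:R],
      [/\ 100 * r%:R * dl <= 1, 100 * r%:R ^+ 2 <= dl * t,
        100 * r%:R * (t * p n) <= dl & 100 * t <= dl * n%:R] &
      forall k : nat, (k <= Num.truncn t)%N ->
        k%:R <= n%:R - (1 - pi_hat r (p n) k) * (n%:R - a_c r n (p n))].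
Proof.
have [d /andP[d0 d1] Hd] := regime_small.
have /andP[c0 _] := linear_const_bounds R r.
have m0 : 0 < Num.min d (@linear_const R r / 2) by rewrite lt_min d0 divr_gt0.
apply: filterS (delta_near m0) => n [p0 y1]; rewrite le_min => /andP[dle dc].
have dg := delta_gt0 s p0 y1; have tg := t0_gt0 s p0 y1.
have dl1 := le_trans dle d1.
have dl01 : 0 <= delta r n (p n) <= d by rewrite (ltW dg).
have [h1 h2 h3 h4 h5] := t0_regime s0 p0 y1 dl1 (Hd _ dl01).
move=> dl t; split=> //; first split=> //.
- exact: t0_eq.
- have : dl * n%:R <= @linear_const R r / 2 * n%:R by rewrite ler_wpM2r.
  by move: h5; rewrite -/dl -/t; lra.
move=> k kt; apply: a_c_barrier => //.
apply: le_lt_trans (pi_hat_upper (hp n) s k) _.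
have tp0 : 0 <= t * p n by rewrite mulr_ge0 ?ltW.
have tp : t * p n < 1.
  have : t * p n <= r%:R * (t * p n) by rewrite ler_peMl // ler1n.
  by move: h3 dl1; rewrite -/dl -/t; lra.
have kp : k%:R * p n <= t * p n.
  rewrite ler_wpM2r ?(ltW p0) //; apply: (@le_trans _ _ (Num.truncn t)%:R).
    by rewrite ler_nat.
  by rewrite truncn_le ltW.
have f1 : 1 <= (r`!)%:R :> R by rewrite ler1n fact_gt0.
have f0 : 0 < (r`!)%:R :> R by rewrite ltr0n fact_gt0.
rewrite ltr_pdivrMr // mul1r; apply: lt_le_trans f1.
apply: (le_lt_trans _ tp); apply: (le_trans _ kp).
have kp0 : 0 <= k%:R * p n by rewrite mulr_ge0 // ltW.
by rewrite exprS ler_piMr // exprn_ile1 // (le_trans kp (ltW tp)).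
Qed.

Let r2 : (2 <= r)%N. Proof. by []. Qed.

Lemma alpha_near (M : R) : 0 < M ->
  \forall n \near \oo, 0 <= alpha n /\ M ^+ 2 * a_c r n (p n) <= alpha n ^+ 2.
Proof.
move=> M0; apply: filterS (halpha_omega M0) => n.
have ac0 := a_c_ge0 s n (hp n).
rewrite ger0_norm ?sqrtr_ge0 // => h.
have al0 : 0 <= alpha n by apply: le_trans h; rewrite mulr_ge0 ?sqrtr_ge0 // ltW.
split=> //; rewrite -[X in _ * X](sqr_sqrtr ac0) -exprMn.
by apply: lerXn2r; rewrite ?nnegrE // mulr_ge0 ?sqrtr_ge0 // ltW.
Qed.

Lemma percolation_near :
  \forall n \near \oo, 1 - 3 * expR (- rate n) <=
    bootstrap_prob (p n) (a n) (fun (E : {set {set 'I_n}}) (A : {set 'I_n}) =>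
      `| #|bootstrap_final r E A|%:R - n%:R | <= err n * n%:R).
Proof.
have [K [K1 KE Kle]] := root4_bounds R r2.
have half : 0 < 2^-1 :> R by rewrite invr_gt0.
apply: filterS (filterI (filterI regime_near (err_near half))
  (filterI (filterI halpha_le ha) (alpha_near ltr01))).
move=> n [[[[p0 tg dg tE tl] [h1 h2 h3 h4] hb] es] [[hl hE] [al0 _]]].
have p1 : p n <= 1 by case/andP: (hp n).
exact: (percolation_prob_ge s0 p0 p1 tg dg tE h1 h2 h3 h4 K1 KE Kle
  (a_c_ge0 s n (hp n)) al0 hl hE hb tl es).
Qed.

Lemma rate_large (M : R) : 0 < M -> \forall n \near \oo, M <= rate n.
Proof.
move=> M0; have k0 : 0 < 48 * M + 1 by lra.
apply: filterS (filterI regime_near (filterI halpha_le (alpha_near k0))).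
move=> n [[[p0 tg dg tE tl] [h1 h2 h3 h4] hb] [hl [al0 hal]]].
rewrite /rate; set t := t0 r n (p n) in tg tE tl h1 h2 h3 h4 hb hl *.
set dl := delta r n (p n) in dg tE h1 h2 h3 h4.
have p1 : p n <= 1 by case/andP: (hp n).
have ac0 := a_c_ge0 s n (hp n).
have acl := ac_lower p0 p1 tg dg tE ac0 hb.
have rR : 2 <= r%:R :> R by rewrite (ler_nat _ 2).
have sR : 1 <= s%:R :> R by rewrite ler1n.
have d200 : dl <= 200^-1.
  have : 2 * dl <= r%:R * dl by rewrite ler_wpM2r // ltW.
  by move: h1; lra.
have t100 : 100 <= t.
  have : 1 <= r%:R ^+ 2 :> R by rewrite exprn_ege1 // ler1n.
  have : dl * t <= t by rewrite ler_piMl ?(ltW tg) //; move: d200; lra.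
  by move: h2; lra.
have act : t / 4 <= a_c r n (p n).
  have tr : t / r%:R <= t / 2 by rewrite ler_wpM2l ?(ltW tg) // lef_pV2 ?posrE ?ltr0n.
  have : (1 + dl) * (t / r%:R) <= (1 + 200^-1) * (t / 2).
    by apply: ler_pM => //; rewrite ?divr_ge0 ?(ltW tg) ?lerD2l //; move: dg; lra.
  by move: acl t100; move: (_ * (t / r%:R)) => z; lra.
have alt : alpha n <= t by move: hl ac0; lra.
have D0 : 0 < 8 * (t + s%:R * alpha n / 2).
  by rewrite mulr_gt0 // ltr_wpDr // divr_ge0 // mulr_ge0 // ler0n.
rewrite ler_pdivlMr //.
have Dle : 8 * (t + s%:R * alpha n / 2) <= 12 * (s%:R * t).
  have : s%:R * alpha n <= s%:R * t by rewrite ler_wpM2l ?ler0n.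
  have : t <= s%:R * t by rewrite ler_peMl // ltW.
  by lra.
apply: le_trans (ler_wpM2l (ltW M0) Dle) _.
have -> : M * (12 * (s%:R * t)) = s%:R * (48 * M * (t / 4)) by field.
rewrite ler_wpM2l ?ler0n //; apply: le_trans hal.
apply: (@le_trans _ _ ((48 * M + 1) ^+ 2 * (t / 4))).
  rewrite ler_wpM2r ?divr_ge0 ?(ltW tg) //.
  have : 48 * M + 1 <= (48 * M + 1) ^+ 2 by rewrite expr2 ler_peMr ?(ltW k0) //; lra.
  by lra.
by rewrite ler_wpM2l // exprn_ge0 // ltW.
Qed.

End Asymptotics.

Local Open Scope classical_set_scope.

Theorem theorem2 (R : realType) (r : nat) (p alpha : nat -> R) (a : nat -> nat)
    (hr : (2 <= r)%N)
    (hp : forall n, 0 <= p n <= 1)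
    (hp_omega : is_littleomega p (fun n => n%:R^-1))
    (hp_o : p =o_\oo (fun n => n%:R `^ (- r%:R^-1)))
    (halpha_omega : is_littleomega alpha (fun n => Num.sqrt (a_c r n (p n))))
    (halpha_le : \forall n \near \oo,
        alpha n <= t0 r n (p n) - a_c r n (p n))
    (ha : \forall n \near \oo, (a n)%:R = a_c r n (p n) + alpha n) :
  exists eps eps1 eps2 : nat -> R,
    [/\ eps @ \oo --> 0, eps1 @ \oo --> 0, eps2 @ \oo --> 0 &
      \forall n \near \oo,
        let t := t0 r n (p n) in
        1 - expR (- ((1 + eps1 n) *
                     (r%:R * alpha n ^+ 2 /
                      (8 * (t + r%:R * alpha n / 3)))))
          - expR (- ((1 + eps2 n) *
                     ((r%:R - 1) * alpha n ^+ 2 /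
                      (8 * (t + (r%:R - 1) * alpha n / 2)))))
        <= bootstrap_prob (p n) (a n)
             (fun (E : {set {set 'I_n}}) (A : {set 'I_n}) =>
                `| #|bootstrap_final r E A|%:R - n%:R | <= eps n * n%:R)].
Proof.
case: r hr hp_o halpha_omega halpha_le ha => [//|s] s1 hp_o hal_om hal_le ha.
have s0 : (0 < s)%N by [].
have ln3 : 0 < ln 3 :> R by rewrite ln_gt0 // ltr1n.
have rate_lg := rate_large s0 hp hp_omega hp_o hal_om hal_le.
exists (err s p), (fun=> 0), (fun n => - ln 3 / rate s p alpha n); split.
- exact: err_cvg.
- exact: cvg_cst.
- apply/cvgr0Pnorm_le => e e0.
  apply: filterS (rate_lg _ (divr_gt0 ln3 e0)) => n h.
  have r0 : 0 < rate s p alpha n by apply: lt_le_trans h; rewrite divr_gt0.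
  rewrite normrM normrN normfV !gtr0_norm // ler_pdivrMr // mulrC.
  by rewrite -ler_pdivrMr.
apply: filterS2 (percolation_near s0 hp hp_omega hp_o hal_om hal_le ha)
  (rate_lg _ ltr01) => n h r1 /=.
have -> : s.+1%:R - 1 = s%:R :> R by rewrite -[s.+1%:R]natr1 addrK.
apply: le_trans h.
rewrite -[X in (1 + - ln 3 / _) * X]/(rate s p alpha n).
have -> : (1 + - ln 3 / rate s p alpha n) * rate s p alpha n = rate s p alpha n - ln 3.
  by field; rewrite gt_eqF // (lt_le_trans _ r1).
by rewrite opprB expRD lnK ?posrE // lerB // gerBl expR_ge0.
Qed.
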